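(* Let $V$ be a vector configuration of rank $r$ containing no copy of the zero vector, and suppose $\mathrm{DD}(V)\le 2$. Then $V$ admits a codegree$^*$ decomposition of length at least $r-\mathrm{DD}(V)$.
   Context: A vector configuration is a finite family (repetitions allowed) $V$ of vectors in $\mathbb{R}^r$; a subconfiguration is a subfamily, $\operatorname{rank}(V)=\dim\operatorname{lin}(V)$, and cardinalities count multiplicities. For a nonzero linear functional $f$, the oriented linear hyperplane $H=\{f=0\}$ has $\overline{H}^-=\{f\le0\}$. The dual codegree of a (sub)configuration $W$ is $\operatorname{codeg}^*(W)=\min_H|\overline{H}^-\cap W|$ over oriented linear hyperplanes $H$. The covector discrepancy is $\mathrm{DD}(W)=\max_f\big|\,|\{w\in W: f(w)>0\}|-|\{w\in W:f(w)<0\}|\,\big|$ over all linear functionals $f$. A codegree$^*$ decomposition of $V$ of length $m$ is a partition $V=V_0\uplus V_1\uplus\dots\uplus V_m$ into subconfigurations ($V_0$ possibly empty) such that $\operatorname{codeg}^*(V)=\sum_{i=1}^m\operatorname{codeg}^*(V_i)$ and $\operatorname{codeg}^*(V_i)\ge1$ for $1\le i\le m$. *)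

(* Defs.v *)
From HB Require Import structures.
From mathcomp Require Import all_boot all_order all_algebra.
From mathcomp Require Import boolp reals.
Set Implicit Arguments. Unset Strict Implicit. Unset Printing Implicit Defensive.
Import Order.TTheory GRing.Theory Num.Theory.
Local Open Scope ring_scope.

(* A vector configuration of N vectors (repetitions allowed) in R^n is a
   matrix V : 'M[R]_(N, n) whose rows are the vectors; it is indexed by 'I_N.
   A subconfiguration is a subset S : {set 'I_N}.
   A linear functional on R^n is f(w) = (w *m u) 0 0 for u : 'cV_n;
   it is nonzero iff u != 0. *)

Section Config.
Variables (R : realType) (N n : nat) (V : 'M[R]_(N, n)).

Definition fval (u : 'cV[R]_n) (i : 'I_N) : R := (row i V *m u) 0 0.

Definition nneg_count (S : {set 'I_N}) (u : 'cV[R]_n) : nat :=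
  #|[set i in S | fval u i <= 0]|.

(* codeg^*(S) = min over oriented linear hyperplanes (u != 0) of
   nneg_count S u.  (If n = 0 there is no hyperplane; convention 0.) *)
Definition codeg_star (S : {set 'I_N}) : nat :=
  match pselect (exists k, `[< exists u : 'cV[R]_n, u != 0 /\ nneg_count S u = k >]) with
  | left h => ex_minn h
  | right _ => 0%N
  end.

Definition pos_count (S : {set 'I_N}) (u : 'cV[R]_n) : nat :=
  #|[set i in S | 0 < fval u i]|.
Definition neg_count (S : {set 'I_N}) (u : 'cV[R]_n) : nat :=
  #|[set i in S | fval u i < 0]|.

Definition disc (S : {set 'I_N}) (u : 'cV[R]_n) : nat :=
  `|(pos_count S u)%:Z - (neg_count S u)%:Z|%N.

Definition DD_pred (S : {set 'I_N}) : pred nat :=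
  fun k => `[< exists u : 'cV[R]_n, disc S u = k >].

Lemma DD_ex (S : {set 'I_N}) : exists k, DD_pred S k.
Proof. by exists (disc S 0); apply/asboolP; exists 0. Qed.

Lemma DD_ub (S : {set 'I_N}) : forall k, DD_pred S k -> (k <= #|S|)%N.
Proof.
move=> k /asboolP [u <-]; rewrite /disc /pos_count /neg_count.
have Ha : (#|[set i in S | (0 < fval u i)%R]| <= #|S|)%N.
  by apply: subset_leq_card; apply/subsetP=> i; rewrite inE => /andP[].
have Hb : (#|[set i in S | (fval u i < 0)%R]| <= #|S|)%N.
  by apply: subset_leq_card; apply/subsetP=> i; rewrite inE => /andP[].
move: Ha Hb.
move: #|[set i in S | 0 < fval u i]| #|[set i in S | fval u i < 0]| => a b Ha Hb.
case: (leqP a b) => hab.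
  by rewrite (distnEr hab); apply: leq_trans (leq_subr a b) Hb.
by rewrite (distnEl (ltnW hab)); apply: leq_trans (leq_subr b a) Ha.
Qed.

Definition DD (S : {set 'I_N}) : nat := ex_maxn (DD_ex S) (@DD_ub S).

(* the subconfigurations V_1, ..., V_m of a partition given by
   c : 'I_N -> option 'I_m  (c i = None  <->  i in V_0) *)
Definition part (m : nat) (c : 'I_N -> option 'I_m) (j : 'I_m) : {set 'I_N} :=
  [set i | c i == Some j].

Definition codeg_decomposition (m : nat) (c : 'I_N -> option 'I_m) : Prop :=
  codeg_star setT = (\sum_(j < m) codeg_star (part c j))%N /\
  (forall j : 'I_m, (1 <= codeg_star (part c j))%N).

End Config.

(* Main.v *)
Require Import Defs.
From HB Require Import structures.
From mathcomp Require Import all_boot all_order all_algebra.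
From mathcomp Require Import zify ring lra.
From mathcomp Require Import boolp reals.
Set Implicit Arguments. Unset Strict Implicit. Unset Printing Implicit Defensive.
Import Order.TTheory GRing.Theory Num.Theory.
Local Open Scope ring_scope.

(* For a zero-free S the extremal functionals can be perturbed off all
   hyperplanes, whence 2 codeg*(S) + DD(S) = |S|.  Removing a pair {v, -cv},
   c > 0, keeps DD, lowers codeg* by one and the rank by at most one, so one may
   assume that no such pair is left.  It remains to see that then the rank is at
   most DD + 1, or DD = 2 and S is the disjoint union of two rank-2 flats of
   discrepancy 1.

   Read S as a point set in projective space.  Perturbing a functional that
   vanishes exactly on a flat F gives DD(F) + DD(S/F) <= DD(S); together with the
   parity of the number of points this controls all flats.
   - If DD = 1, every line carries an odd number of points, hence at least 3, and
     the Sylvester-Gallai theorem makes S collinear.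
   - If DD = 2, odd lines have at least 3 points, planes have an even number of
     points, and the even lines through a point x (counted once) are coplanar,
     by the case DD <= 1 applied to S/x.  In rank >= 4 this forces every plane
     over an odd line l to be l plus a single point: otherwise every point of the
     plane lies on exactly one even line; the even lines meeting a given odd line
     are concurrent, hence by Sylvester-Gallai in the dual plane all of them pass
     through one point b, and the plane together with b violates
     Sylvester-Gallai.  Finally the points off l span only odd lines, so they are
     collinear. *)

(** * Linear functionals, spans and perturbation *)

Section Functionals.
Variables (R : realFieldType) (n : nat).
Implicit Types (x y z : 'rV[R]_n) (f g u : 'cV[R]_n).

Definition ev x u : R := (x *m u) 0 0.

Lemma evDl x y u : ev (x + y) u = ev x u + ev y u.
Proof. by rewrite /ev mulmxDl mxE. Qed.

Lemma evZl c x u : ev (c *: x) u = c * ev x u.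
Proof. by rewrite /ev -scalemxAl mxE. Qed.

Lemma evDr x u g : ev x (u + g) = ev x u + ev x g.
Proof. by rewrite /ev mulmxDr mxE. Qed.

Lemma evZr c x u : ev x (c *: u) = c * ev x u.
Proof. by rewrite /ev -scalemxAr mxE. Qed.

Lemma evNr x u : ev x (- u) = - ev x u.
Proof. by rewrite -scaleN1r evZr mulN1r. Qed.

Lemma ev0l u : ev 0 u = 0.
Proof. by rewrite /ev mul0mx mxE. Qed.

Lemma evBl x y u : ev (x - y) u = ev x u - ev y u.
Proof. by rewrite evDl -scaleN1r evZl mulN1r. Qed.

Lemma ev_sumZl (I : finType) (P : pred I) (c : I -> R) (x : I -> 'rV[R]_n) u :
  ev (\sum_(i | P i) c i *: x i) u = \sum_(i | P i) c i * ev (x i) u.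
Proof.
rewrite /ev mulmx_suml summxE; apply: eq_bigr => i _.
by rewrite -scalemxAl mxE.
Qed.

Lemma ev_sub m (A : 'M[R]_(m, n)) x u : A *m u = 0 -> (x <= A)%MS -> ev x u = 0.
Proof. by move=> Au /submxP[D ->]; rewrite /ev -mulmxA Au mulmx0 mxE. Qed.

Lemma ev_rV0 x u : (x *m u = 0) <-> (ev x u = 0).
Proof.
split=> [h|h]; first by rewrite /ev h mxE.
by apply/matrixP=> i j; rewrite !ord1 [RHS]mxE; exact: h.
Qed.

Lemma kills_adds m (A : 'M[R]_(m, n)) x u :
  A *m u = 0 -> ev x u = 0 -> (A + x)%MS *m u = 0.
Proof.
move=> Au /ev_rV0 xu.
have /submxP[D ->] : (A + x <= col_mx A x)%MS by rewrite addsmxE.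
by rewrite -mulmxA mul_col_mx Au xu col_mx0 mulmx0.
Qed.

Lemma kills_sub m p (A : 'M[R]_(m, n)) (B : 'M[R]_(p, n)) u :
  (A <= B)%MS -> B *m u = 0 -> A *m u = 0.
Proof. by move=> /submxP[D ->] Bu; rewrite -mulmxA Bu mulmx0. Qed.

Lemma sub_ev m (A : 'M[R]_(m, n)) x :
  (forall u, A *m u = 0 -> ev x u = 0) -> (x <= A)%MS.
Proof.
move=> h; rewrite submxE; apply/eqP/matrixP=> i j.
move: (cokermx A) (mulmx_coker A) => C AC.
have := h (col j C); rewrite /ev colE !mulmxA AC mul0mx.
by rewrite -colE mxE ord1 [X in _ -> _ = X]mxE; apply.
Qed.

Lemma add_rVP m (A : 'M[R]_(m, n)) x y :
  reflect (exists c, (x - c *: y <= A)%MS) (x <= A + y)%MS.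
Proof.
apply: (iffP sub_addsmxP) => [[[u w] /= ->]|[c /submxP[D h]]].
  exists (w 0 0); rewrite {1}[w]mx11_scalar mul_scalar_mx addrK.
  exact: submxMl.
by exists (D, c%:M) => /=; rewrite -h mul_scalar_mx subrK.
Qed.

Lemma span_exchange m (A : 'M[R]_(m, n)) x y :
  (x <= A + y)%MS -> ~~ (x <= A)%MS -> (y <= A + x)%MS.
Proof.
case/add_rVP=> c h nx.
have c0 : c != 0.
  by apply: contraNneq nx => c0; move: h; rewrite c0 scale0r subr0.
apply/add_rVP; exists c^-1.
have -> : y - c^-1 *: x = - (c^-1 *: (x - c *: y)).
  by rewrite scalerBr scalerA mulVf // scale1r opprB.
by rewrite eqmx_opp scalemx_sub.
Qed.

Lemma rank_add_rV_le m (A : 'M[R]_(m, n)) x : (\rank (A + x)%MS <= (\rank A).+1)%N.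
Proof.
apply: leq_trans (mxrank_adds_leqif A x) _.
by have := rank_leq_row x; lia.
Qed.

Lemma rank_add_rV m (A : 'M[R]_(m, n)) x :
  ~~ (x <= A)%MS -> \rank (A + x)%MS = (\rank A).+1.
Proof.
move=> nx; apply/eqP; rewrite eqn_leq rank_add_rV_le /=.
rewrite ltn_neqAle mxrankS ?addsmxSl // andbT.
have [_ ->] := mxrank_leqif_sup (addsmxSl A x).
by rewrite addsmx_sub submx_refl.
Qed.

Lemma sub_line_eq x y (a b : 'rV[R]_n) : (a <= x + y)%MS -> (b <= x + y)%MS ->
  a != 0 -> ~~ (b <= a)%MS -> (x + y <= a + b)%MS.
Proof.
move=> ha hb a0 hab.
have sub : (a + b <= x + y)%MS by rewrite addsmx_sub ha.
have [le1 <-] := mxrank_leqif_sup sub.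
rewrite eqn_leq le1 (rank_add_rV hab) rank_rV a0 /=.
rewrite (leq_trans (rank_add_rV_le _ _)) // rank_rV.
by case: (x != 0).
Qed.

Lemma sub_plane_eq x y z (a b c : 'rV[R]_n) : (a <= x + y + z)%MS -> (b <= x + y + z)%MS ->
  (c <= x + y + z)%MS ->
  a != 0 -> ~~ (b <= a)%MS -> ~~ (c <= a + b)%MS -> (x + y + z <= a + b + c)%MS.
Proof.
move=> ha hb hc a0 hab habc.
have sub : (a + b + c <= x + y + z)%MS by rewrite !addsmx_sub ha hb.
have [le1 <-] := mxrank_leqif_sup sub.
rewrite eqn_leq le1 (rank_add_rV habc) (rank_add_rV hab) rank_rV a0 /=.
rewrite (leq_trans (rank_add_rV_le _ _)) // ltnS.
rewrite (leq_trans (rank_add_rV_le _ _)) // rank_rV.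
by case: (x != 0).
Qed.

Lemma rV_parC x y : x != 0 -> (x <= y)%MS -> (y <= x)%MS.
Proof.
move=> x0 /sub_rVP[c hx]; apply/sub_rVP; exists c^-1.
have c0 : c != 0 by apply: contra_neq x0 => c0; rewrite hx c0 scale0r.
by rewrite hx scalerA mulVf // scale1r.
Qed.

Lemma perturbed_sign (T : finType) (x : T -> 'rV[R]_n) f g :
  exists2 e : R, 0 < e & forall i, sgz (ev (x i) (f + e *: g)) =
    if ev (x i) f == 0 then sgz (ev (x i) g) else sgz (ev (x i) f).
Proof.
(* The sign of [f] at [x i] survives once [e * r i < 1]. Where [f] vanishes, division by zero gives
   [r i = 0]; the summand 1 below makes the bound strict. *)
pose r i := `|ev (x i) g| / `|ev (x i) f|.
have r0 i : 0 <= r i by rewrite divr_ge0.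
have s0 : 0 < 1 + \sum_i r i by rewrite ltr_pwDl // sumr_ge0.
exists (1 + \sum_i r i)^-1; first by rewrite invr_gt0.
move=> i; rewrite evDr evZr; set e := _^-1.
have e0 : 0 < e by rewrite invr_gt0.
case: eqP => [->|/eqP nf]; first by rewrite add0r sgzM (gtr0_sgz e0) mul1r.
have lt : e * `|ev (x i) g| < `|ev (x i) f|.
  rewrite mulrC ltr_pdivrMr // mulrC -ltr_pdivrMr ?normr_gt0 //.
  by rewrite (bigD1 i) //= ltr_pwDl // lerDl sumr_ge0.
move: nf lt; have [fp|fn|->] := ltrgt0P (ev (x i) f); last by [].
- move=> _ lt; rewrite (gtr0_sgz fp) gtr0_sgz //.
  have := ler_norm (- (e * ev (x i) g)).
  by rewrite normrN normrM (gtr0_norm e0) => ?; lra.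
- move=> _ lt; rewrite (ltr0_sgz fn) ltr0_sgz //.
  have := ler_norm (e * ev (x i) g).
  by rewrite normrM (gtr0_norm e0) => ?; lra.
Qed.

(** The vectors outside [A] are handled in turn: adding a small multiple of a functional that kills
    [A] but not the new vector keeps all earlier nonzero values nonzero. *)
Lemma generic_functional (T : finType) (x : T -> 'rV[R]_n) m (A : 'M[R]_(m, n)) :
  exists2 u, A *m u = 0 & forall i, ~~ (x i <= A)%MS -> ev (x i) u != 0.
Proof.
suff [u Au hu] : exists2 u, A *m u = 0 &
    forall i, i \in enum T -> ~~ (x i <= A)%MS -> ev (x i) u != 0.
  by exists u => // i; apply: hu; rewrite mem_enum.
elim: (enum T) => [|j s [u Au hu]]; first by exists 0; rewrite ?mulmx0.
case: (boolP (x j <= A)%MS) => hj.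
  exists u => // i; rewrite inE => /orP[/eqP->|]; [by rewrite hj|exact: hu].
have [g Ag gj] : exists2 g, A *m g = 0 & ev (x j) g != 0.
  apply/not_exists2P => h; move/negP: hj; apply; apply: sub_ev => g Ag.
  by case: (h g) => // /negP; rewrite negbK => /eqP.
have [e e0 he] := perturbed_sign x u g.
exists (u + e *: g); first by rewrite mulmxDr -scalemxAr Au Ag scaler0 addr0.
move=> i; rewrite -[ev _ (_ + _) == 0]sgz_eq0 he inE => /orP[/eqP->|hi] ni.
  by case: ifP => [_|/negbT]; rewrite sgz_eq0.
by rewrite (negbTE (hu _ hi ni)) sgz_eq0 hu.
Qed.

End Functionals.

(** * The Sylvester-Gallai theorem: affine, projective, modulo a subspace *)

Section SylvesterGallai.
Variables (R : realFieldType) (n : nat).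
Implicit Types (a b c d p q r x y : 'rV[R]_n).

Definition dot x y : R := ev x y^T.

Lemma dotC x y : dot x y = dot y x.
Proof. by rewrite /dot /ev -[in LHS](trmxK x) -trmx_mul mxE. Qed.

Lemma dotxx_ge0 x : 0 <= dot x x.
Proof.
by rewrite /dot /ev mxE sumr_ge0 // => i _; rewrite mxE -expr2 sqr_ge0.
Qed.

Lemma dotxx_eq0 x : (dot x x == 0) = (x == 0).
Proof.
apply/eqP/eqP => [|->]; last by rewrite /dot ev0l.
rewrite /dot /ev mxE => /eqP; rewrite psumr_eq0; last first.
  by move=> i _; rewrite mxE -expr2 sqr_ge0.
move/allP=> h; apply/rowP=> i; rewrite mxE; apply/eqP.
by have := h i (mem_index_enum i); rewrite /= mxE -expr2 sqrf_eq0.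
Qed.

Lemma dotxx_gt0 x : x != 0 -> 0 < dot x x.
Proof. by rewrite lt_def dotxx_ge0 dotxx_eq0 => ->. Qed.

Lemma dotBl x y a : dot (x - y) a = dot x a - dot y a.
Proof. exact: evBl. Qed.

Lemma dotZl (s : R) x a : dot (s *: x) a = s * dot x a.
Proof. exact: evZl. Qed.

Lemma dotBr x y a : dot a (x - y) = dot a x - dot a y.
Proof. by rewrite dotC dotBl !(dotC a). Qed.

Lemma dotZr (s : R) x a : dot a (s *: x) = s * dot a x.
Proof. by rewrite dotC dotZl dotC. Qed.

(* Squared distance from [p] to the line through [a] and [b]. *)
Definition dist2 p a b : R :=
  dot (p - a) (p - a) - dot (p - a) (b - a) ^+ 2 / dot (b - a) (b - a).

Lemma foot_decomposition p a b : a != b -> exists t r,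
  [/\ p = a + t *: (b - a) + r, dot r (b - a) = 0 & dist2 p a b = dot r r].
Proof.
rewrite eq_sym -subr_eq0 /dist2; move: (b - a) => d d0.
have Dn : dot d d != 0 by rewrite gt_eqF // dotxx_gt0.
have -> : p = a + (p - a) by rewrite addrC subrK.
rewrite [a + (p - a) - a]addrAC subrr add0r; move: (p - a) => w.
pose t := dot w d / dot d d; exists t, (w - t *: d); split.
- by rewrite -addrA [t *: d + _]addrC subrK.
- by rewrite dotBl dotZl /t divfK // subrr.
by rewrite !(dotBl, dotBr, dotZl, dotZr) (dotC d w) /t; field.
Qed.

(** Kelly's configuration, with the foot [q] of the perpendicular [r] as origin: of two points of
    the line on the same side of [q], the nearer one is closer to the line joining the farther one
    to [q + r] than [q + r] is to the original line. *)
Lemma closer_pair q d r (be ga : R) : dot r d = 0 -> r != 0 -> d != 0 ->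
  0 <= be * ga -> be ^+ 2 < ga ^+ 2 ->
  [/\ q + r != q + ga *: d, 0 < dist2 (q + be *: d) (q + r) (q + ga *: d)
    & dist2 (q + be *: d) (q + r) (q + ga *: d) < dot r r].
Proof.
move=> rd r0 d0 bg lt.
have D0 := dotxx_gt0 d0; have H0 := dotxx_gt0 r0.
have dr : dot d r = 0 by rewrite dotC.
have neq : q + r != q + ga *: d.
  apply: contra_neq r0 => /addrI h; apply/eqP; rewrite -dotxx_eq0 {2}h.
  by rewrite dotC /dot evZl -/(dot _ _) dr mulr0.
have E (s : R) : q + s *: d - (q + r) = s *: d - r.
  by rewrite opprD addrACA subrr add0r.
have G : 0 < ga ^+ 2 * dot d d + dot r r by rewrite ltr_wpDl // mulr_ge0 ?sqr_ge0 // ltW.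
have dE : dist2 (q + be *: d) (q + r) (q + ga *: d) =
    dot r r * (dot d d * (be - ga) ^+ 2) / (ga ^+ 2 * dot d d + dot r r).
  rewrite /dist2 !E !(dotBl, dotBr, dotZl, dotZr) rd dr; field.
  by rewrite gt_eqF.
have bg_neq : 0 < (be - ga) ^+ 2.
  rewrite lt0r sqr_ge0 andbT sqrf_eq0 subr_eq0.
  by apply: contraTneq lt => ->; rewrite ltxx.
rewrite dE; split=> //; first by rewrite divr_gt0 // (mulr_gt0 H0) // (mulr_gt0 D0).
rewrite ltr_pdivrMr // ltr_pM2l //.
have le : (be - ga) ^+ 2 <= ga ^+ 2 by nra.
have := ler_wpM2l (ltW D0) le; lra.
Qed.

(** By pigeonhole on signs, two of the numbers have nonnegative product; being distinct, they cannot
    have equal squares. *)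
Lemma same_side_pair (t1 t2 t3 : R) : t1 != t2 -> t1 != t3 -> t2 != t3 ->
  exists be ga, [/\ be \in [:: t1; t2; t3], ga \in [:: t1; t2; t3],
    0 <= be * ga & be ^+ 2 < ga ^+ 2].
Proof.
move=> n12 n13 n23.
have aux (a b : R) : a != b -> a \in [:: t1; t2; t3] -> b \in [:: t1; t2; t3] ->
    0 <= a * b -> exists be ga, [/\ be \in [:: t1; t2; t3],
    ga \in [:: t1; t2; t3], 0 <= be * ga & be ^+ 2 < ga ^+ 2].
  move=> nab ha hb ab; case: (ltrgtP (a ^+ 2) (b ^+ 2)) => [h|h|/eqP h].
  - by exists a, b.
  - by exists b, a; rewrite mulrC.
  - move: h; rewrite eqf_sqr (negbTE nab) => /eqP h; exfalso; move/eqP: nab; apply.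
    by nra.
have in1 : t1 \in [:: t1; t2; t3] by rewrite !inE eqxx.
have in2 : t2 \in [:: t1; t2; t3] by rewrite !inE eqxx orbT.
have in3 : t3 \in [:: t1; t2; t3] by rewrite !inE eqxx !orbT.
case: (lerP 0 (t1 * t2)) => h12; first exact: aux n12 _ _ h12.
case: (lerP 0 (t1 * t3)) => h13; first exact: aux n13 _ _ h13.
by apply: aux n23 _ _ _ => //; nra.
Qed.

(* Kelly's argument: among the pairs (point, line) of positive distance, one
   of minimal distance leads to a contradiction. *)
Lemma sylvester_gallai_affine (T : finType) (A : {set T}) (y : T -> 'rV[R]_n) :
  (forall i j, i \in A -> j \in A -> y i != y j -> exists k,
     [/\ k \in A, exists t, y k = y i + t *: (y j - y i), y k != y i & y k != y j]) ->
  forall i j k, i \in A -> j \in A -> k \in A -> y i != y j ->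
  exists t, y k = y i + t *: (y j - y i).
Proof.
move=> third i0 j0 k0 iA jA kA nij; apply/not_existsP => notin.
pose P (w : T * T * T) := [&& w.1.1 \in A, w.1.2 \in A, w.2 \in A,
  y w.1.1 != y w.1.2 & 0 < dist2 (y w.2) (y w.1.1) (y w.1.2)].
have P0 : P (i0, j0, k0).
  rewrite /P /= iA jA kA nij /=; have [t [r [hk _ ->]]] := foot_decomposition (y k0) nij.
  apply: dotxx_gt0; apply/eqP => r0; apply: (notin t).
  by rewrite hk r0 addr0.
case: (arg_minP (fun w => dist2 (y w.2) (y w.1.1) (y w.1.2)) P0) => -[[i j] k] /=.
case/and5P=> /= {}iA {}jA {}kA {}nij dpos dmin.
have [t [r [hk rd dE]]] := foot_decomposition (y k) nij.
have [l [lA [tl hl] nli nlj]] := third _ _ iA jA nij.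
set d := y j - y i in hk rd hl; pose q := y i + t *: d.
have d0 : d != 0 by rewrite subr_eq0 eq_sym.
have r0 : r != 0 by rewrite -dotxx_eq0 gt_eqF // -dE.
have qE (s : R) : q + (s - t) *: d = y i + s *: d.
  by rewrite /q -addrA -scalerDl [t + _]addrC subrK.
have hi : y i = q + (0 - t) *: d by rewrite qE scale0r addr0.
have hj : y j = q + (1 - t) *: d by rewrite qE scale1r /d addrC subrK.
have hl' : y l = q + (tl - t) *: d by rewrite qE.
have [be [ga [hbe hga bg lt]]] : exists be ga, [/\ be \in [:: 0 - t; 1 - t; tl - t],
    ga \in [:: 0 - t; 1 - t; tl - t], 0 <= be * ga & be ^+ 2 < ga ^+ 2].
  apply: same_side_pair.
  - by apply/eqP; lra.
  - apply: contra_neq nli => h; rewrite hl' -h -hi //.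
  - apply: contra_neq nlj => h; rewrite hl' -h -hj //.
have pick s : s \in [:: 0 - t; 1 - t; tl - t] -> exists2 m, m \in A & y m = q + s *: d.
  rewrite !inE => /or3P[] /eqP->; [by exists i | by exists j | by exists l].
have [b bA yb] := pick _ hbe; have [c cA yc] := pick _ hga.
have [n1 n2 n3] := closer_pair q rd r0 d0 bg lt.
have hk' : y k = q + r by [].
have := dmin (k, c, b); rewrite dE /P /= kA cA bA hk' yc yb n1 n2 => /(_ isT).
by rewrite leNgt n3.
Qed.

Lemma affine_lineP x y z u : ev x u = 1 -> ev y u = 1 -> ev z u = 1 ->
  (z <= x + y)%MS <-> exists t, z = x + t *: (y - x).
Proof.
move=> hx hy hz; split=> [/add_rVP[c /sub_rVP[e h]]|[t ->]].
  exists c; have ec : e + c = 1.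
    have := congr1 (fun w : 'rV[R]_n => ev w u) h; rewrite evBl !evZl hx hy hz; lra.
  have -> : z = e *: x + c *: y by rewrite -h subrK.
  have -> : e = 1 - c by lra.
  by rewrite scalerBr scalerBl scale1r -addrA [- _ + _]addrC.
rewrite addmx_sub ?addsmxSl // scalemx_sub // addmx_sub ?addsmxSr //.
by rewrite eqmx_opp addsmxSl.
Qed.

(** A generic functional vanishes at none of the points, so they can be scaled into the affine chart
    where it equals 1. There proportional vectors become equal points and spans of two vectors
    become affine lines. *)
Theorem sylvester_gallai (T : finType) (A : {set T}) (x : T -> 'rV[R]_n) :
  (forall i, i \in A -> x i != 0) ->
  (forall i j, i \in A -> j \in A -> ~~ (x j <= x i)%MS -> exists k,
     [/\ k \in A, (x k <= x i + x j)%MS, ~~ (x k <= x i)%MS & ~~ (x k <= x j)%MS]) ->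
  forall i j k, i \in A -> j \in A -> k \in A -> ~~ (x j <= x i)%MS ->
  (x k <= x i + x j)%MS.
Proof.
move=> x0 third.
have [u _ hu] := generic_functional x (0 : 'M[R]_n).
have ux i : i \in A -> ev (x i) u != 0 by move=> iA; rewrite hu // submx0 x0.
pose y i := (ev (x i) u)^-1 *: x i.
have y1 i : i \in A -> ev (y i) u = 1 by move=> iA; rewrite evZl mulVf // ux.
have yE i : i \in A -> (y i :=: x i)%MS.
  by move=> iA; apply: eqmx_scale; rewrite invr_eq0 ux.
have yeq i j : i \in A -> j \in A -> (y i == y j) = (x i <= x j)%MS.
  move=> iA jA; apply/eqP/idP => [h|].
    by rewrite -(yE i iA) h (yE j jA).
  rewrite -(yE i iA) -(yE j jA) => /sub_rVP[c h].
  have := congr1 (fun w : 'rV[R]_n => ev w u) h; rewrite /= [X in _ = X]evZl !y1 // mulr1 => c1.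
  by rewrite h -c1 scale1r.
have lineE i j k : i \in A -> j \in A -> k \in A ->
    (x k <= x i + x j)%MS <-> exists t, y k = y i + t *: (y j - y i).
  move=> iA jA kA.
  rewrite -(affine_lineP (y1 i iA) (y1 j jA) (y1 k kA)) (yE k kA).
  by rewrite (adds_eqmx (yE i iA) (yE j jA)).
move=> i j k iA jA kA nij; apply/lineE => //.
apply: (@sylvester_gallai_affine _ A) => // [i' j' iA' jA'|]; last first.
  by rewrite eq_sym yeq.
rewrite eq_sym yeq // => /(third _ _ iA' jA')[l [lA l1 l2 l3]].
by exists l; split; rewrite ?yeq //; apply/lineE.
Qed.

End SylvesterGallai.

(** Multiplication by the cokernel matrix realises the quotient by [U], where the projective theorem
    applies. *)
Lemma sylvester_gallai_mod (R : realFieldType) n m (U : 'M[R]_(m, n)) (T : finType)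
    (A : {set T}) (x : T -> 'rV[R]_n) :
  (forall i, i \in A -> ~~ (x i <= U)%MS) ->
  (forall i j, i \in A -> j \in A -> ~~ (x j <= U + x i)%MS -> exists k,
     [/\ k \in A, (x k <= U + x i + x j)%MS, ~~ (x k <= U + x i)%MS
       & ~~ (x k <= U + x j)%MS]) ->
  forall i j k, i \in A -> j \in A -> k \in A -> ~~ (x j <= U + x i)%MS ->
  (x k <= U + x i + x j)%MS.
Proof.
move=> x0 third; pose C := cokermx U.
have E1 i j : (x j *m C <= x i *m C)%MS = (x j <= U + x i)%MS.
  apply/sub_rVP/add_rVP => -[c h]; exists c.
    by rewrite submxE mulmxBl -scalemxAl h subrr.
  by apply/eqP; rewrite -subr_eq0 scalemxAl -mulmxBl -submxE.
have E2 i j k : (x k *m C <= x i *m C + x j *m C)%MS = (x k <= U + x i + x j)%MS.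
  apply/add_rVP/add_rVP => -[c h]; exists c.
    move: h; rewrite scalemxAl -mulmxBl => /sub_rVP[e h]; apply/add_rVP; exists e.
    by rewrite submxE mulmxBl -scalemxAl h subrr.
  case/add_rVP: h => e h; rewrite scalemxAl -mulmxBl; apply/sub_rVP; exists e.
  by apply/eqP; rewrite -subr_eq0 scalemxAl -mulmxBl -submxE.
move=> i j k iA jA kA; rewrite -E1 -E2.
apply: (@sylvester_gallai _ _ _ A (fun i => x i *m C)) => // [l lA|a b aA bA].
  by rewrite -submxE x0.
rewrite E1 => /(third _ _ aA bA)[l [lA l1 l2 l3]].
by exists l; rewrite E2 !E1.
Qed.

(** * Sign sums, flats and points of a contraction *)

Section SignSums.
Variables (R : realFieldType) (n : nat) (T : finType) (v : T -> 'rV[R]_n).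
Implicit Types (S X : {set T}) (f g u : 'cV[R]_n) (i j k : T) (D : nat).

Definition sgsum S u : int := \sum_(i in S) sgz (ev (v i) u).

Definition flat S m (A : 'M[R]_(m, n)) : {set T} := [set i in S | (v i <= A)%MS].

(** Functionals killing [U] are those of the quotient by [U], so this bounds the discrepancy of the
    contraction [S/U]; vectors inside [U] contribute zero. *)
Definition bounded S m (U : 'M[R]_(m, n)) D :=
  forall u, U *m u = 0 -> (`|sgsum S u| <= D)%N.

Lemma sgsumN S u : sgsum S (- u) = - sgsum S u.
Proof. by rewrite /sgsum -sumrN; apply: eq_bigr => i _; rewrite evNr sgzN. Qed.

Lemma odd_absz_sgsum S u :
  odd `|sgsum S u|%N = odd #|[set i in S | ev (v i) u != 0]|.
Proof.
have m1 : {morph (fun x : int => odd `|x|%N) : x y / x + y >-> addb x y}.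
  by move=> x y /=; lia.
rewrite -sum1_card /sgsum (big_morph _ m1 (erefl _)) (big_morph _ oddD (erefl _)).
rewrite [RHS](eq_bigl (fun i => (i \in S) && (ev (v i) u != 0))); last first.
  by move=> i; rewrite inE.
rewrite big_mkcondr; apply: eq_bigr => i _.
by rewrite sgz_def; case: (_ == _); case: (_ < _).
Qed.

Lemma sgsum_flat S m (A : 'M[R]_(m, n)) u :
  sgsum (flat S A) u = \sum_(i in S) if (v i <= A)%MS then sgz (ev (v i) u) else 0.
Proof. by rewrite -big_mkcondr; apply: eq_bigl => i; rewrite inE. Qed.

(** This is DD(F) + DD(S/F) <= DD(S), relative to [U]. In a perturbed functional [f] decides the
    signs first, then a functional vanishing exactly on [F], and [g] only those on [F]. *)
Lemma flat_bound S m p (U : 'M[R]_(m, n)) (F : 'M[R]_(p, n)) D f g :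
  bounded S U D -> (U <= F)%MS -> F *m f = 0 -> U *m g = 0 ->
  (`|sgsum S f| + `|sgsum (flat S F) g| <= D)%N.
Proof.
move=> bS UF Ff Ug.
(* The contribution of the points off [F] at which [f] happens to vanish. It changes sign with its
   argument, so it cancels on averaging over [f'] and [- f']. *)
pose c f' : int := \sum_(i in S)
  if (ev (v i) f == 0) && ~~ (v i <= F)%MS then sgz (ev (v i) f') else 0.
have cN f' : c (- f') = - c f'.
  by rewrite /c -sumrN; apply: eq_bigr => i _; rewrite evNr sgzN; case: ifP; rewrite ?oppr0.
have [f' Ff' hf'] := generic_functional v F.
have key f'' g' : F *m f'' = 0 -> (forall i, ~~ (v i <= F)%MS -> ev (v i) f'' != 0) ->
    U *m g' = 0 -> (`|(sgsum S f + sgsum (flat S F) g' + c f'')%R| <= D)%N.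
  move=> Ff'' hf'' Ug'.
  have [e1 _ he1] := perturbed_sign v f'' g'.
  have [e2 _ he2] := perturbed_sign v f (f'' + e1 *: g').
  suff -> : sgsum S f + sgsum (flat S F) g' + c f'' = sgsum S (f + e2 *: (f'' + e1 *: g')).
    apply: bS; rewrite !(mulmxDr, =^~ scalemxAr) Ug' (kills_sub UF Ff'') (kills_sub UF Ff).
    by rewrite !(scaler0, addr0).
  rewrite sgsum_flat -!big_split /=; apply: eq_bigr => i _.
  rewrite he2 he1; case: (boolP (v i <= F)%MS) => hi.
    by rewrite (ev_sub Ff hi) (ev_sub Ff'' hi) eqxx sgz0 add0r addr0.
  by rewrite (negbTE (hf'' _ hi)) addr0; case: eqP => [->|_]; rewrite ?sgz0 ?add0r ?addr0.
have FN : F *m (- f') = 0 by rewrite mulmxN Ff' oppr0.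
have UN : U *m (- g) = 0 by rewrite mulmxN Ug oppr0.
have hN i : ~~ (v i <= F)%MS -> ev (v i) (- f') != 0.
  by move=> hi; rewrite evNr oppr_eq0 hf'.
(* The four choices of signs for [f'] and [g] bound the sum and the difference of the two sign sums
   by [D], hence also the sum of their absolute values. *)
have := key _ _ Ff' hf' Ug; have := key _ _ FN hN Ug.
have := key _ _ Ff' hf' UN; have := key _ _ FN hN UN.
rewrite !sgsumN cN; lia.
Qed.

Lemma bounded_flat S m p (U : 'M[R]_(m, n)) (F : 'M[R]_(p, n)) D :
  bounded S U D -> (U <= F)%MS -> bounded (flat S F) U D.
Proof.
move=> bS UF u Uu; have := flat_bound bS UF (mulmx0 _ _) Uu; lia.
Qed.

(** For [v i] outside [U] this is one point of the contraction [S/U], with its multiplicity. *)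
Definition cls S m (U : 'M[R]_(m, n)) i : {set T} :=
  [set j in S | (v j <= U + v i)%MS && ~~ (v j <= U)%MS].

Lemma cls_refl S m (U : 'M[R]_(m, n)) i :
  i \in S -> ~~ (v i <= U)%MS -> i \in cls S U i.
Proof. by move=> iS iU; rewrite inE iS addsmxSr. Qed.

Lemma cls_eq S m (U : 'M[R]_(m, n)) i j :
  j \in cls S U i -> cls S U j = cls S U i.
Proof.
rewrite inE => /and3P[jS ji nj]; apply/setP=> k; rewrite !inE.
have ij := span_exchange ji nj.
suff -> : (v k <= U + v j)%MS = (v k <= U + v i)%MS by [].
apply/idP/idP => h; apply: submx_trans h _.
  by rewrite addsmx_sub addsmxSl.
by rewrite addsmx_sub addsmxSl.
Qed.

Lemma class_sum0 (M : zmodType) S X m (U : 'M[R]_(m, n)) (G : T -> M) :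
  (forall i, i \in X -> i \in cls S U i) ->
  (forall i, i \in X -> cls S U i \subset X) ->
  (forall i, i \in X -> \sum_(j in cls S U i) G j = 0) ->
  \sum_(i in X) G i = 0.
Proof.
move=> refl clX sum0.
rewrite (partition_big (cls S U) xpredT) //= big1 // => A _.
case: (pickP [pred i | (i \in X) && (cls S U i == A)]) => [i /= /andP[iX /eqP iA]|none].
  rewrite (eq_bigl (fun j => j \in cls S U i)) ?sum0 // => j.
  apply/andP/idP => [[jX /eqP jA]|ji]; first by rewrite iA -jA refl.
  by rewrite (subsetP (clX i iX)) // (cls_eq ji) iA.
by rewrite big_pred0 // => i; exact: none.
Qed.

Lemma even_classes S X m (U : 'M[R]_(m, n)) :
  (forall i, i \in X -> i \in cls S U i) ->
  (forall i, i \in X -> cls S U i \subset X) ->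
  (forall i, i \in X -> ~~ odd #|cls S U i|) -> ~~ odd #|X|.
Proof.
move=> refl clX ev; have p2 := pchar_Fp (isT : prime 2).
have E (A : {set T}) : ~~ odd #|A| = (\sum_(i in A) (1 : 'F_2) == 0).
  by rewrite sumr_const -(dvdn_pcharf p2) dvdn2.
rewrite E; apply/eqP/(class_sum0 refl clX) => i iX.
by apply/eqP; rewrite -E ev.
Qed.

Lemma cls_bound S m (U : 'M[R]_(m, n)) D i u :
  bounded S U D -> U *m u = 0 -> (`|sgsum (cls S U i) u| <= D)%N.
Proof.
move=> bS Uu; have := bounded_flat bS (addsmxSl U (v i)) Uu.
suff -> : sgsum (flat S (U + v i)%MS) u = sgsum (cls S U i) u by [].
rewrite sgsum_flat; rewrite /sgsum [RHS](eq_bigl (fun j => (j \in S) &&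
  ((v j <= U + v i)%MS && ~~ (v j <= U)%MS))); last by move=> j; rewrite inE.
rewrite [RHS]big_mkcondr; apply: eq_bigr => j _; case: ifP => //= _.
by case: ifP => // /negbFE /(ev_sub Uu) ->; rewrite sgz0.
Qed.

End SignSums.

(** * Parity of points, lines and planes *)

Section Parity.
Variables (R : realFieldType) (n : nat) (T : finType) (v : T -> 'rV[R]_n).
Implicit Types (S X : {set T}) (f g u : 'cV[R]_n) (i j k : T) (D : nat).

Notation sgsum := (sgsum v).
Notation flat := (flat v).
Notation bounded := (bounded v).
Notation cls := (cls v).
Notation zero := (0 : 'M[R]_n).

(* The scalar [c = 0] is covered, so this also excludes zero vectors. *)
Definition antipodal_free S :=
  forall i j c, i \in S -> j \in S -> v j = c *: v i -> 0 < c.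

Lemma antipodal_free_neq0 S i : antipodal_free S -> i \in S -> v i != 0.
Proof.
move=> aS iS; apply/eqP => vi0.
by have := aS i i 0 iS iS; rewrite scale0r vi0 ltxx => /(_ erefl).
Qed.

Lemma antipodal_freeS S X : X \subset S -> antipodal_free S -> antipodal_free X.
Proof. by move=> /subsetP sXS aS i j c iX jX; apply: aS; exact: sXS. Qed.

Lemma in_flat S m (A : 'M[R]_(m, n)) i : (i \in flat S A) = (i \in S) && (v i <= A)%MS.
Proof. by rewrite inE. Qed.

Lemma in_cls S m (U : 'M[R]_(m, n)) i j :
  (j \in cls S U i) = [&& j \in S, (v j <= U + v i)%MS & ~~ (v j <= U)%MS].
Proof. by rewrite inE. Qed.

Lemma flat_subset S m (A : 'M[R]_(m, n)) : flat S A \subset S.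
Proof. by apply/subsetP => i; rewrite inE => /andP[]. Qed.

Lemma flat_eqmx S m p (A : 'M[R]_(m, n)) (B : 'M[R]_(p, n)) :
  (A :=: B)%MS -> flat S A = flat S B.
Proof. by move=> AB; apply/setP => i; rewrite !inE AB. Qed.

Lemma flat_flat S m p (A : 'M[R]_(m, n)) (B : 'M[R]_(p, n)) :
  (A <= B)%MS -> flat (flat S B) A = flat S A.
Proof.
move=> AB; apply/setP => i; rewrite !inE -andbA.
by case: (boolP (v i <= A)%MS) => [h|]; rewrite ?andbF // (submx_trans h AB).
Qed.

(** Without antipodal vectors, all vectors on the line of [v i] are positive multiples of it, so
    their signs agree. *)
Lemma sgsum_point S i u : antipodal_free S -> i \in S -> ev (v i) u != 0 ->
  `|sgsum (flat S (v i)) u|%N = #|flat S (v i)|.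
Proof.
move=> aS iS iu; rewrite /sgsum (eq_bigr (fun=> sgz (ev (v i) u))).
  by rewrite sumr_const -mulr_natr abszM natz absz_nat sgz_def iu; case: (_ < 0); rewrite mul1n.
move=> j; rewrite inE => /andP[jS /sub_rVP[c hc]].
by rewrite hc evZl sgzM (gtr0_sgz (aS _ _ _ iS jS hc)) mul1r.
Qed.

Lemma point_bound S D i f : antipodal_free S -> bounded S zero D -> i \in S ->
  ev (v i) f = 0 -> (`|sgsum S f| + #|flat S (v i)| <= D)%N.
Proof.
move=> aS bS iS fi; have [g _ hg] := generic_functional v zero.
rewrite -(@sgsum_point _ _ g aS iS); last by rewrite hg // submx0 (antipodal_free_neq0 aS).
by apply: (flat_bound bS (sub0mx _ _)); rewrite ?mul0mx //; apply/ev_rV0.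
Qed.

Lemma point_card_le S D i : antipodal_free S -> bounded S zero D -> i \in S ->
  (#|flat S (v i)| <= D)%N.
Proof.
move=> aS bS iS; have := @point_bound S D i 0 aS bS iS.
by rewrite /ev mulmx0 mxE => /(_ erefl); lia.
Qed.

Lemma zero_set_bound S D u g : bounded S zero D ->
  (`|sgsum S u| + `|sgsum (flat S (kermx u)) g| <= D)%N.
Proof.
by move=> bS; apply: (flat_bound bS (sub0mx _ _)); rewrite ?mul0mx // mulmx_ker.
Qed.

Lemma sub_kermx_ev i u : (v i <= kermx u)%MS = (ev (v i) u == 0).
Proof. by apply/sub_kermxP/eqP => /ev_rV0. Qed.

(** The sign sums of [u] on [S] and of a generic [g] on the zero set of [u] have parities adding up
    to that of the odd [#|S|]. Their absolute values total at most 2, hence at most 1. *)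
Lemma odd_bounded1 S : (forall i, i \in S -> v i != 0) -> bounded S zero 2 ->
  odd #|S| -> bounded S zero 1.
Proof.
move=> nz bS oS u _; have [g _ hg] := generic_functional v zero.
have := zero_set_bound u g bS.
have := odd_absz_sgsum v (flat S (kermx u)) g.
have := odd_absz_sgsum v S u.
have -> : [set i in flat S (kermx u) | ev (v i) g != 0] = S :\: [set i in S | ev (v i) u != 0].
  apply/setP=> i; rewrite !inE sub_kermx_ev; case: (boolP (i \in S)) => //= iS.
  by rewrite andbT negbK hg ?andbT // submx0 nz.
rewrite cardsDS; last by apply/subsetP=> i; rewrite inE => /andP[].
have : (#|[set i in S | ev (v i) u != 0%R]| <= #|S|)%N.
  by apply: subset_leq_card; apply/subsetP=> i; rewrite inE => /andP[].
by move=> le e1 e2; move: oS; lia.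
Qed.

(** In [S/U], points of odd multiplicity are collinear. By Sylvester-Gallai it suffices to find a
    third one on the line of any two. If there were none, the rest [Y] of that line would have even
    size; then the point [i] and the contraction of the line by it would both have odd discrepancy,
    against the bound 1 for their sum. *)
Lemma odd_classes_coplanar S m (U : 'M[R]_(m, n)) i j k :
  bounded S U 1 -> i \in S -> j \in S -> k \in S ->
  ~~ (v i <= U)%MS -> ~~ (v j <= U)%MS -> ~~ (v k <= U)%MS ->
  odd #|cls S U i| -> odd #|cls S U j| -> odd #|cls S U k| ->
  ~~ (v j <= U + v i)%MS -> (v k <= U + v i + v j)%MS.
Proof.
move=> bS iS jS kS iU jU kU oi oj ok.
pose A := [set i in S | ~~ (v i <= U)%MS & odd #|cls S U i|].
apply: (@sylvester_gallai_mod _ _ _ U _ A); rewrite ?inE ?iS ?jS ?kS ?iU ?jU ?kU //.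
  by move=> l; rewrite inE => /and3P[].
move=> {i j k iS jS kS iU jU kU oi oj ok} i j; rewrite !inE.
case/and3P=> iS iU oi /and3P[jS jU oj] nij; apply/not_existsP => none.
pose F := (U + v i + v j)%MS; pose S' := flat S F.
have UF : (U <= F)%MS by exact: submx_trans (addsmxSl U (v i)) (addsmxSl _ _).
have UiF : (U + v i <= F)%MS by rewrite addsmxSl.
have UjF : (U + v j <= F)%MS by rewrite addsmx_sub UF addsmxSr.
pose Y := [set k in S' | ~~ (v k <= U + v i)%MS & ~~ (v k <= U + v j)%MS].
have evY : ~~ odd #|Y|.
  have YU k : k \in Y -> [/\ k \in S, (v k <= F)%MS, ~~ (v k <= U)%MS,
      ~~ (v k <= U + v i)%MS & ~~ (v k <= U + v j)%MS].
    rewrite !inE => /and3P[/andP[kS kF] ki kj]; split=> //.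
    by apply: contraNN ki => h; apply: submx_trans h (addsmxSl _ _).
  apply: (@even_classes _ _ _ v S Y _ U) => k /YU[kS kF kU ki kj].
  - exact: cls_refl.
  - apply/subsetP=> l; rewrite in_cls => /and3P[lS lk lU].
    have kl := span_exchange lk lU.
    rewrite !inE lS /=; apply/and3P; split.
    + by apply: submx_trans lk _; rewrite addsmx_sub UF.
    + apply: contraNN ki => h; apply: submx_trans kl _.
      by rewrite addsmx_sub addsmxSl.
    + apply: contraNN kj => h; apply: submx_trans kl _.
      by rewrite addsmx_sub addsmxSl.
  - by apply/negP=> ok; apply: (none k); rewrite !inE kS kU ok.
have [f Uf hf] := generic_functional v (U + v i)%MS.
have [g Ug hg] := generic_functional v U.
have oX : odd `|sgsum S' f|%N.
  rewrite odd_absz_sgsum.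
  have -> : [set k in S' | ev (v k) f != 0] = Y :|: cls S U j.
    apply/setP=> k; rewrite inE [k \in Y :|: _]inE in_cls.
    have -> : (ev (v k) f != 0) = ~~ (v k <= U + v i)%MS.
      by apply/idP/idP => [|/hf //]; apply: contraNN => h; rewrite (ev_sub Uf h).
    rewrite /Y [k \in [set _ in S' | _ & _]]inE /S' in_flat.
    case: (boolP (k \in S)) => //= kS.
    case: (boolP (v k <= U + v j)%MS) => kj /=; last by rewrite andbT orbF.
    rewrite (submx_trans kj UjF) /= andbF /=.
    apply/idP/idP; apply: contraNN => h; first exact: submx_trans h (addsmxSl _ _).
    apply: contraLR nij => kU; rewrite negbK.
    apply: submx_trans (span_exchange kj kU) _.
    by rewrite addsmx_sub addsmxSl.
  rewrite cardsU (_ : Y :&: _ = set0) ?cards0 ?subn0 ?oddD ?(negbTE evY) //.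
  by apply/setP=> k; rewrite !inE; case: (v k <= U + v j)%MS; rewrite ?andbF.
have oI : odd `|sgsum (flat S' (U + v i)%MS) g|%N.
  rewrite odd_absz_sgsum (_ : [set _ in _ | _] = cls S U i) //.
  apply/setP=> k; rewrite inE /S' flat_flat // in_flat in_cls -andbA.
  case: (k \in S) => //=; case: (v k <= U + v i)%MS => //=.
  by apply/idP/idP => [|/hg //]; apply: contraNN => h; rewrite (ev_sub Ug h).
have := flat_bound (bounded_flat bS UF) (addsmxSl U (v i)) Uf Ug.
by move: oX oI; rewrite -/S'; lia.
Qed.

Lemma cls0E S i : antipodal_free S -> i \in S -> cls S zero i = flat S (v i).
Proof.
move=> aS iS; apply/setP=> j; rewrite !inE adds0mx submx0.
by case: (boolP (j \in S)) => //= jS; rewrite (antipodal_free_neq0 aS jS) andbT.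
Qed.

Lemma point_refl S i : i \in S -> i \in flat S (v i).
Proof. by move=> iS; rewrite inE iS submx_refl. Qed.

Lemma bounded1_collinear S i j k : antipodal_free S -> bounded S zero 1 ->
  i \in S -> j \in S -> k \in S -> ~~ (v j <= v i)%MS -> (v k <= v i + v j)%MS.
Proof.
move=> aS bS iS jS kS nij.
have nz l : l \in S -> ~~ (v l <= zero)%MS.
  by move=> lS; rewrite submx0 (antipodal_free_neq0 aS).
have o1 l : l \in S -> odd #|cls S zero l|.
  move=> lS; rewrite cls0E //; have := point_card_le aS bS lS.
  have : (0 < #|flat S (v l)|)%N by apply/card_gt0P; exists l; exact: point_refl.
  lia.
have e0 : (zero + v i :=: v i)%MS by exact: adds0mx.
rewrite -(adds_eqmx e0 (eqmx_refl (v j))).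
by apply: odd_classes_coplanar bS _ _ _ _ _ _ _ _ _ _; rewrite ?nz ?o1 // e0.
Qed.

Lemma odd_collinear S i j k : antipodal_free S -> bounded S zero 2 -> odd #|S| ->
  i \in S -> j \in S -> k \in S -> ~~ (v j <= v i)%MS -> (v k <= v i + v j)%MS.
Proof.
move=> aS bS oS; apply: bounded1_collinear => //.
by apply: odd_bounded1 => // l; exact: antipodal_free_neq0.
Qed.

Lemma plane_even S i j k : antipodal_free S -> bounded S zero 2 ->
  i \in S -> j \in S -> k \in S -> ~~ (v j <= v i)%MS -> ~~ (v k <= v i + v j)%MS ->
  ~~ odd #|flat S (v i + v j + v k)%MS|.
Proof.
move=> aS bS iS jS kS nij; apply: contraNN => oP.
have aP := antipodal_freeS (flat_subset S (v i + v j + v k)%MS) aS.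
have bP := bounded_flat bS (sub0mx n (v i + v j + v k)%MS).
have ij : (v i + v j <= v i + v j + v k)%MS by rewrite addsmxSl.
move: (ij); rewrite addsmx_sub => /andP[hi hj].
by apply: odd_collinear oP _ _ _ nij => //; rewrite in_flat ?iS ?jS ?kS ?hi ?hj ?addsmxSr.
Qed.

(** By oddness the discrepancy of the line is at most 1, so its points are simple; two of them alone
    would make an even line. *)
Lemma odd_line S i j : antipodal_free S -> bounded S zero 2 ->
  i \in S -> j \in S -> ~~ (v j <= v i)%MS -> odd #|flat S (v i + v j)%MS| ->
  [/\ flat S (v i) = [set i], flat S (v j) = [set j] &
   exists k, [/\ k \in S, (v k <= v i + v j)%MS, ~~ (v k <= v i)%MS & ~~ (v k <= v j)%MS]].
Proof.
move=> aS bS iS jS nij oP; set P := flat S _ in oP.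
have aP : antipodal_free P := antipodal_freeS (flat_subset S _) aS.
have bP : bounded P zero 1.
  apply: odd_bounded1 oP; first by move=> i' /(antipodal_free_neq0 aP).
  exact: bounded_flat bS (sub0mx _ _).
have one l : l \in S -> (v l <= v i + v j)%MS -> flat S (v l) = [set l].
  move=> lS lij; apply/eqP; rewrite eq_sym eqEcard sub1set point_refl //= cards1.
  rewrite -(flat_flat S lij); apply: point_card_le bP _ => //.
  by rewrite in_flat lS lij.
have fi := one i iS (addsmxSl _ _); have fj := one j jS (addsmxSr _ _).
split=> //; apply/not_existsP => none; move: oP.
have -> : P = [set i; j]; last first.
  rewrite cards2; case: eqP nij => // ->.
  by rewrite submx_refl.
apply/setP=> k; rewrite in_flat; apply/andP/idP => [[kS kij]|].
  apply/negPn/negP => nk; apply: (none k); split=> //; apply: contraNN nk => h.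
    by rewrite in_set2; apply/orP; left; rewrite -in_set1 -fi in_flat kS.
  by rewrite in_set2; apply/orP; right; rewrite -in_set1 -fj in_flat kS.
by rewrite in_set2 => /orP[] /eqP->; rewrite ?iS ?jS ?addsmxSl ?addsmxSr.
Qed.

(** Sylvester-Gallai yields a line with only two directions, and the discrepancy bound 2 forces both
    to be simple. *)
Lemma ordinary_line S i j k : antipodal_free S -> bounded S zero 2 ->
  i \in S -> j \in S -> k \in S -> ~~ (v j <= v i)%MS -> ~~ (v k <= v i + v j)%MS ->
  exists a b, [/\ a \in S, b \in S, ~~ (v b <= v a)%MS & flat S (v a + v b)%MS = [set a; b]].
Proof.
move=> aS bS iS jS kS nij; apply: contraNP => none.
apply: (@sylvester_gallai _ _ _ S) => // [l /(antipodal_free_neq0 aS) //|a b aA bA nab].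
apply/not_existsP => none2; apply: none; exists a, b; split=> //.
set P := flat S _.
have aP : antipodal_free P := antipodal_freeS (flat_subset S _) aS.
have bP : bounded P zero 2 by exact: bounded_flat bS (sub0mx _ _).
have PE : P = flat S (v a) :|: flat S (v b).
  apply/setP=> l; rewrite in_setU !in_flat; case: (boolP (l \in S)) => //= lS.
  apply/idP/orP => [lab|].
    by apply/orP/negPn; rewrite negb_or; apply/negP=> /andP[la lb]; apply: (none2 l).
  by case=> h; apply: submx_trans h _; rewrite ?addsmxSl ?addsmxSr.
(* As [f] vanishes at [a] and not at [b], its sign sum on [P] is the multiplicity of [b] up to sign;
   by [point_bound] the two multiplicities add up to at most 2. *)
have [f fa hf] := generic_functional v (v a).
have aPP : a \in P by rewrite in_flat aA addsmxSl.
have bPP : b \in P by rewrite in_flat bA addsmxSr.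
have fa0 : ev (v a) f = 0 by exact/ev_rV0.
have := point_bound aP bP aPP fa0.
have -> : sgsum P f = sgsum (flat P (v b)) f.
  rewrite sgsum_flat; apply: eq_bigr => l; rewrite {1}PE in_setU !in_flat.
  case: (v l <= v b)%MS => //=; rewrite andbF orbF => /andP[_ h].
  by rewrite (ev_sub fa h) sgz0.
rewrite sgsum_point //; last exact: hf.
have [ca cb] : (0 < #|flat P (v a)|)%N /\ (0 < #|flat P (v b)|)%N.
  by split; apply/card_gt0P; [exists a | exists b]; exact: point_refl.
rewrite !flat_flat ?addsmxSl ?addsmxSr // in ca cb *.
move=> le2; rewrite PE.
have /eqP fa1 : flat S (v a) == [set a].
  by rewrite eq_sym eqEcard sub1set point_refl //= cards1; lia.
have /eqP fb1 : flat S (v b) == [set b].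
  by rewrite eq_sym eqEcard sub1set point_refl //= cards1; lia.
by rewrite fa1 fb1.
Qed.

Lemma line_card S i j :
  #|flat S (v i + v j)%MS| = (#|cls S (v i) j| + #|flat S (v i)|)%N.
Proof.
rewrite -(cardsID (flat S (v i))) addnC; congr (_ + _)%N; apply: eq_card => k.
  by rewrite inE !in_flat in_cls; case: (k \in S); rewrite //= andbC.
rewrite inE !in_flat; case: (k \in S) => //=.
by case: (boolP (v k <= v i)%MS) => h; rewrite ?andbF // (submx_trans h (addsmxSl _ _)).
Qed.

Lemma odd_cls_even_line S i j : flat S (v i) = [set i] ->
  odd #|cls S (v i) j| = ~~ odd #|flat S (v i + v j)%MS|.
Proof. by move=> fi; rewrite line_card fi cards1 addn1 /= negbK. Qed.

(** If all lines through [i] were odd, all classes modulo [v i] would be even; together with [i]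
    they would make [#|S|] odd. *)
Lemma exists_even_line S i : flat S (v i) = [set i] -> ~~ odd #|S| -> i \in S ->
  exists j, [/\ j \in S, ~~ (v j <= v i)%MS & ~~ odd #|flat S (v i + v j)%MS|].
Proof.
move=> fi evS iS; apply/not_existsP => none.
have : ~~ odd #|S :\ i|.
  have nS j : j \in S :\ i -> j \in S /\ ~~ (v j <= v i)%MS.
    rewrite in_setD1 => /andP[ji jS]; split=> //; apply: contraNN ji => h.
    by rewrite -in_set1 -fi in_flat jS.
  apply: (@even_classes _ _ _ v S _ _ (v i)) => j /nS[jS ji].
  - exact: cls_refl.
  - apply/subsetP=> k; rewrite in_cls in_setD1 => /and3P[-> _ ki]; rewrite andbT.
    by apply: contraNneq ki => ->.
  - by rewrite odd_cls_even_line // negbK; apply/negP => /negP e; apply: (none j).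
by move: evS; rewrite (cardsD1 i S) iS /= negbK => ->.
Qed.

Lemma simple_bounded1 S i : antipodal_free S -> bounded S zero 2 -> i \in S ->
  flat S (v i) = [set i] -> bounded S (v i) 1.
Proof.
by move=> aS bS iS fi u /ev_rV0 /(point_bound aS bS iS); rewrite fi cards1 addn1.
Qed.

(** Even lines through a simple point are the odd points of the contraction by it, whose discrepancy
    is at most 1. *)
Lemma even_lines_coplanar S i j k l : antipodal_free S -> bounded S zero 2 ->
  i \in S -> j \in S -> k \in S -> l \in S ->
  flat S (v i) = [set i] -> ~~ (v j <= v i)%MS -> ~~ (v l <= v i)%MS ->
  ~~ odd #|flat S (v i + v j)%MS| -> ~~ odd #|flat S (v i + v k)%MS| ->
  ~~ odd #|flat S (v i + v l)%MS| ->
  ~~ (v k <= v i + v j)%MS -> (v l <= v i + v j + v k)%MS.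
Proof.
move=> aS bS iS jS kS lS fi nij nil ej ek el nk.
have b1 := simple_bounded1 aS bS iS fi.
apply: (odd_classes_coplanar b1 _ _ _ _ _ _ _ _ _ nk); rewrite ?odd_cls_even_line //.
by apply: contraNN nk => h; apply: submx_trans h (addsmxSl _ _).
Qed.

End Parity.

(** * A plane containing an odd line *)

Section Plane.
Variables (R : realFieldType) (n : nat) (T : finType) (v : T -> 'rV[R]_n).
Implicit Types (f g u : 'cV[R]_n) (a b i j k l w x z : T).

Notation zero := (0 : 'M[R]_n).

Lemma line_eqmx i j k : (v k <= v i + v j)%MS -> ~~ (v k <= v i)%MS ->
  (v i + v k :=: v i + v j)%MS.
Proof.
move=> kij nk; apply/eqmxP/andP; split; first by rewrite addsmx_sub addsmxSl.
by rewrite addsmx_sub addsmxSl; apply: span_exchange.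
Qed.

Variables (P : {set T}) (q1 q2 q3 : T).
Hypotheses (aP : antipodal_free v P) (bP : bounded v P zero 2) (evP : ~~ odd #|P|).
Hypotheses (q1P : q1 \in P) (q2P : q2 \in P) (q3P : q3 \in P).
Hypotheses (q12 : ~~ (v q2 <= v q1)%MS) (q123 : ~~ (v q3 <= v q1 + v q2)%MS).

Local Notation Q := (v q1 + v q2 + v q3)%MS.
Local Notation even_line a b := (~~ odd #|flat v P (v a + v b)%MS|).

Hypothesis (planeP : forall l, l \in P -> (v l <= Q)%MS).
(** Supplied by [even_pencil] in rank at least 4. Its use: a simple point on an odd line lies on at
    most one even line of the plane. *)
Hypothesis pencilP : forall x a b l, x \in P -> a \in P -> b \in P -> l \in P ->
  flat v P (v x) = [set x] -> ~~ (v a <= v x)%MS -> ~~ (v b <= v x + v a)%MS ->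
  ~~ (v l <= v x)%MS -> even_line x a -> even_line x b -> even_line x l.

Lemma plane_neq0 i : i \in P -> v i != 0.
Proof. exact: antipodal_free_neq0. Qed.

Lemma plane_parC i j : i \in P -> ~~ (v j <= v i)%MS -> ~~ (v i <= v j)%MS.
Proof. by move=> iP; apply: contraNN; apply: rV_parC; exact: plane_neq0. Qed.

Lemma even_lineC a b : even_line a b = even_line b a.
Proof. by rewrite addsmxC. Qed.

Lemma even_line_eq i j k : (v k <= v i + v j)%MS -> ~~ (v k <= v i)%MS ->
  even_line i k = even_line i j.
Proof. by move=> h1 h2; rewrite (flat_eqmx _ _ (line_eqmx h1 h2)). Qed.

Lemma off_line (x y : 'rV[R]_n) : exists2 l, l \in P & ~~ (v l <= x + y)%MS.
Proof.
apply/not_exists2P => h.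
have all l : l \in P -> (v l <= x + y)%MS by move=> lP; case: (h l) => // /negP; rewrite negbK.
have : (Q <= x + y)%MS by rewrite !addsmx_sub !all.
move/mxrankS; rewrite (rank_add_rV q123) (rank_add_rV q12) rank_rV plane_neq0 //.
have := rank_add_rV_le x y; have := rank_leq_row x; lia.
Qed.

Lemma odd_lineP a b : a \in P -> b \in P -> ~~ (v b <= v a)%MS -> ~~ even_line a b ->
  [/\ flat v P (v a) = [set a], flat v P (v b) = [set b] &
   exists k, [/\ k \in P, (v k <= v a + v b)%MS, ~~ (v k <= v a)%MS & ~~ (v k <= v b)%MS]].
Proof. by move=> ? ? ?; rewrite negbK; exact: odd_line. Qed.

Variables (i j : T).
Hypotheses (iP : i \in P) (jP : j \in P) (nij : ~~ (v j <= v i)%MS).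
Hypothesis odd_ij : ~~ even_line i j.

(** Such a [z], an apex, turns out to be the one point of the plane off the odd line. *)
Definition all_even z := forall x, x \in P -> ~~ (v x <= v z)%MS -> even_line z x.

(** * Planes with an apex *)

Section Apex.
Variables (z : T) (zP : z \in P) (evz : all_even z).

Lemma apex_off_odd a b : a \in P -> b \in P -> ~~ (v b <= v a)%MS ->
  ~~ even_line a b -> ~~ (v z <= v a + v b)%MS.
Proof.
move=> aA bA nab; apply: contraNN => h.
case: (boolP (v z <= v a)%MS) => za.
  have az := rV_parC (plane_neq0 zP) za.
  have zb : ~~ (v b <= v z)%MS.
    by apply: contraNN nab => h'; exact: submx_trans h' za.
  have -> : even_line a b = even_line z b.
    have e : (v a :=: v z)%MS by apply/eqmxP/andP.
    by rewrite (flat_eqmx _ _ (adds_eqmx e (eqmx_refl (v b)))).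
  exact: evz.
by rewrite -(even_line_eq h za) even_lineC evz // plane_parC.
Qed.

(** A point of an odd line has at most one even line, so its lines to [z] and [z'] coincide. For [i]
    and [j] this puts both on the line of [z] and [z'], which would then be an odd line through an
    apex. *)
Lemma apex_unique z' : z' \in P -> all_even z' -> (v z' <= v z)%MS.
Proof.
move=> zP' evz'; apply/negPn/negP => nz.
have nz' : ~~ (v z <= v i + v j)%MS by exact: apex_off_odd.
have nji := plane_parC iP nij.
have through a b : a \in P -> b \in P -> ~~ (v b <= v a)%MS -> ~~ even_line a b ->
    ~~ (v z <= v a + v b)%MS -> (v a <= v z + v z')%MS.
  move=> aA bA nab oab zab.
  have [fa _ _] := odd_lineP aA bA nab oab.
  have za : ~~ (v z <= v a)%MS.
    by apply: contraNN zab => h; exact: submx_trans h (addsmxSl _ _).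
  have eaz : even_line a z by rewrite even_lineC evz // plane_parC.
  have z'a : (v z' <= v a + v z)%MS.
    apply/negPn/negP => h; move/negP: oab; apply.
    apply: (pencilP aA zP zP' bA fa za h nab eaz).
    rewrite even_lineC evz' // plane_parC //.
    by apply: contraNN h => h'; exact: submx_trans h' (addsmxSl _ _).
  by apply: span_exchange nz; rewrite addsmxC.
have hi := through _ _ iP jP nij odd_ij nz'.
have hj : (v j <= v z + v z')%MS.
  by apply: through jP iP nji _ _; rewrite ?(even_lineC j) // addsmxC.
have := sub_line_eq hi hj (plane_neq0 iP) nij.
by rewrite addsmx_sub (negbTE nz').
Qed.

(** Since [z] is the only apex, [x] lies on an odd line. So [x] is simple and its only even line is
    the one to [z]. *)
Lemma apex_even_line x l : x \in P -> l \in P -> ~~ (v x <= v z)%MS ->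
  ~~ (v l <= v x)%MS -> even_line x l ->
  flat v P (v x) = [set x] /\ (v l <= v x + v z)%MS.
Proof.
move=> xP lP nx nl exl.
have [a [aA na oa]] : exists a, [/\ a \in P, ~~ (v a <= v x)%MS & ~~ even_line x a].
  apply/not_existsP => none; move/negP: nx; apply; apply: apex_unique => // a aA na.
  by apply: contraT => oa; case: (none a).
have [fx _ _] := odd_lineP xP aA na oa; split=> //.
apply/negPn/negP => h; move/negP: oa; apply.
apply: (pencilP xP zP lP aA fx _ h na) => //; first exact: plane_parC.
by rewrite even_lineC evz.
Qed.

Lemma apex_simple x : x \in P -> ~~ (v x <= v z)%MS -> flat v P (v x) = [set x].
Proof.
move=> xP nx; apply: (apex_even_line xP zP nx _ _).1; first exact: plane_parC.
by rewrite even_lineC evz.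
Qed.

(** An ordinary line has two points, so it is even and passes through the apex; hence [z] is one of
    its two points, which are simple. *)
Lemma apex_point : flat v P (v z) = [set z].
Proof.
have [a [b [aA bA nab fab]]] := ordinary_line aP bP q1P q2P q3P q12 q123.
have eab : even_line a b.
  by rewrite fab cards2; case: eqP nab => // ->; rewrite submx_refl.
have sub x : (v x <= v a + v b)%MS -> x \in P -> flat v P (v x) \subset [set a; b].
  move=> xab xP; rewrite -fab; apply/subsetP=> y; rewrite !in_flat => /andP[-> h].
  exact: submx_trans h xab.
have zab : z \in [set a; b].
  rewrite -fab in_flat zP /=.
  case: (boolP (v a <= v z)%MS) => az.
    exact: submx_trans (rV_parC (plane_neq0 aA) az) (addsmxSl _ _).
  have [_ h] := apex_even_line aA bA az nab eab.
  exact: span_exchange h nab.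
have hz : (v z <= v a + v b)%MS by move: zab; rewrite -fab in_flat => /andP[].
apply/eqP; rewrite eqEsubset sub1set point_refl // andbT; apply/subsetP=> y yz.
have := subsetP (sub z hz zP) _ yz; move: yz; rewrite in_flat => /andP[yP yz].
have nba := plane_parC aA nab.
move: zab; rewrite !in_set2 in_set1 => /orP[] /eqP zE /orP[] /eqP yE; rewrite zE yE ?eqxx //.
  by move: nab; rewrite -yE -zE yz.
by move: nba; rewrite -yE -zE yz.
Qed.

(** Sylvester-Gallai on [P :\ z]: an odd line misses [z] and has a third point, while an even line
    contains [a], [b], [z] and by parity a fourth point. *)
Lemma apex_rest k : k \in P -> k != z -> (v k <= v i + v j)%MS.
Proof.
move=> kP kz.
have offz a : a \in P :\ z -> a \in P /\ ~~ (v a <= v z)%MS.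
  rewrite in_setD1 => /andP[az aA]; split=> //; apply: contraNN az => h.
  by rewrite -in_set1 -apex_point in_flat aA.
have nz := apex_off_odd iP jP nij odd_ij.
have iz : i != z by apply: contraNneq nz => <-; rewrite addsmxSl.
have jz : j != z by apply: contraNneq nz => <-; rewrite addsmxSr.
apply: (@sylvester_gallai _ _ _ (P :\ z)); rewrite ?in_setD1 ?iz ?jz ?kz //.
  by move=> l /offz[/plane_neq0].
move=> a b /offz[aA na] /offz[bA nb] nab.
case: (boolP (even_line a b)) => eab; last first.
  have [_ _ [l [lP l1 l2 l3]]] := odd_lineP aA bA nab eab.
  exists l; rewrite in_setD1 lP andbT; split=> //.
  by apply: contraNneq (apex_off_odd aA bA nab eab) => <-.
have [fa hb] := apex_even_line aA bA na nab eab.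
have fb := apex_simple bA nb.
have zab := span_exchange hb nab.
have sub : [set a; b; z] \subset flat v P (v a + v b)%MS.
  apply/subsetP=> y; rewrite !inE -orbA => /or3P[] /eqP->.
  - by rewrite aA addsmxSl.
  - by rewrite bA addsmxSr.
  - by rewrite zP zab.
have c3 : #|[set a; b; z]| = 3%N.
  rewrite cardsU cards2 cards1 (_ : _ :&: _ = set0) ?cards0.
    by case: eqP nab => // ->; rewrite submx_refl.
  apply/setP=> y; rewrite !inE; case: (y =P z) => [->|]; rewrite ?andbF // andbT.
  apply/negbTE; rewrite negb_or; apply/andP; split.
    by apply: contraNneq na => <-.
  by apply: contraNneq nb => <-.
have /properP[_ [l]] : [set a; b; z] \proper flat v P (v a + v b)%MS.
  rewrite properEcard sub c3 ltn_neqAle -{2}c3 subset_leq_card // andbT.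
  by apply: contraNneq eab => <-.
rewrite in_flat !inE => /andP[lP lab]; rewrite !negb_or => /andP[/andP[la lb] lz].
exists l; rewrite in_setD1 lz lP; split=> //.
  by apply: contraNN la => h; rewrite -in_set1 -fa in_flat lP.
by apply: contraNN lb => h; rewrite -in_set1 -fb in_flat lP.
Qed.

End Apex.

(** * Planes without an apex *)

Section NoApex.
Hypothesis no_apex : forall z, z \in P -> ~ all_even z.

Lemma no_apex_odd z : z \in P ->
  exists a, [/\ a \in P, ~~ (v a <= v z)%MS & ~~ even_line z a].
Proof.
move=> zP; apply/not_existsP => none; apply: (no_apex zP) => a aA na.
by apply: contraT => oa; case: (none a).
Qed.

Lemma no_apex_simple z : z \in P -> flat v P (v z) = [set z].
Proof.
by move=> zP; have [a [aA na oa]] := no_apex_odd zP; case: (odd_lineP zP aA na oa).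
Qed.

(** Existence comes from the parity of [P], uniqueness from [pencilP] and an odd line through [x].
    Membership is assumed under the existential so that a choice function on all of [T] can be
    extracted. *)
Lemma unique_even_line x : exists y, x \in P -> [/\ y \in P, ~~ (v y <= v x)%MS,
  even_line x y & forall l, l \in P -> ~~ (v l <= v x)%MS -> even_line x l ->
  (v l <= v x + v y)%MS].
Proof.
case: (boolP (x \in P)) => xP; last by exists x.
have fx := no_apex_simple xP.
have [y [yP ny exy]] := exists_even_line fx evP xP.
exists y => _; split=> // l lP nl exl; apply: contraT => h.
have [a [aA na]] := no_apex_odd xP.
by rewrite (pencilP xP yP lP aA fx ny h na exy exl).
Qed.

(** * Even lines as points of the dual plane *)

Section Dual.
Variables (y : T -> T) (f : T -> 'cV[R]_n).
Hypothesis yP : forall x, x \in P -> [/\ y x \in P, ~~ (v (y x) <= v x)%MS,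
  even_line x (y x) & forall l, l \in P -> ~~ (v l <= v x)%MS -> even_line x l ->
  (v l <= v x + v (y x))%MS].
Local Notation eline x := (v x + v (y x))%MS.
Hypothesis fP : forall x, eline x *m f x = 0 /\
  forall l, ~~ (v l <= eline x)%MS -> ev (v l) (f x) != 0.

Lemma elineE x l : x \in P -> l \in P -> ~~ (v l <= v x)%MS ->
  (v l <= eline x)%MS = even_line x l.
Proof.
move=> xP lP nl; have [_ _ ey uy] := yP xP.
by apply/idP/idP => [h|]; [rewrite (even_line_eq h nl) | exact: uy].
Qed.

(* The weighted sum [b] of the points off an odd line: modulo a point [x] of
   that line the points of every odd line through [x] cancel, so that [b] lies
   on the even line through [x]. *)
Lemma even_lines_concurrent a c : a \in P -> c \in P -> ~~ (v c <= v a)%MS ->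
  ~~ even_line a c -> exists b : 'rV[R]_n, [/\ (b <= Q)%MS, ~~ (b <= v a + v c)%MS
    & forall x, x \in P -> (v x <= v a + v c)%MS -> (b <= eline x)%MS].
Proof.
move=> aA cP nac oac.
have [phi phi0 hphi] := generic_functional v (v a + v c)%MS.
pose X := P :\: flat v P (v a + v c)%MS.
have XE l : (l \in X) = (l \in P) && ~~ (v l <= v a + v c)%MS.
  by rewrite inE in_flat; case: (l \in P); rewrite ?andbF //= andbT.
have oX : odd #|X|.
  rewrite cardsDS ?flat_subset // oddB ?subset_leq_card ?flat_subset //.
  by move: oac evP; rewrite negbK => -> /negbTE ->.
(* With these weights [phi] takes at [b] the value [sgsum v X phi], which is odd because [#|X|] is;
   so [b] is off the line. *)
pose b := \sum_(l in X) `|ev (v l) phi|^-1 *: v l.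
have sgE (r : R) : `|r|^-1 * r = (sgz r)%:~R.
  rewrite -sgrEz; case: (ltrgt0P r) => h; last by rewrite h sgr0 mulr0.
    by rewrite gtr0_sg // mulVf // gt_eqF.
  by rewrite ltr0_sg // invrN mulNr mulVf // lt_eqF.
exists b; split.
- by apply: summx_sub => l; rewrite XE => /andP[lP _]; rewrite scalemx_sub // planeP.
- apply/negP => /(ev_sub phi0); rewrite ev_sumZl.
  under eq_bigr do rewrite sgE.
  rewrite -rmorph_sum => /eqP; rewrite intr_eq0 => /eqP s0.
  have := odd_absz_sgsum v X phi; rewrite /sgsum s0 /=.
  rewrite (_ : [set _ in X | _] = X) ?oX //.
  apply/setP=> l; rewrite [LHS]inE; case: (boolP (l \in X)) => //=.
  by rewrite XE => /andP[_ /hphi].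
move=> x xP xac; apply: sub_ev => u eu; rewrite ev_sumZl.
have b1 := simple_bounded1 aP bP xP (no_apex_simple xP).
have phix : v x *m phi = 0 by exact: kills_sub xac phi0.
have nx l : l \in X -> ~~ (v l <= v x)%MS.
  by rewrite XE => /andP[_]; apply: contraNN => h; exact: submx_trans h xac.
have clX l : l \in X -> cls v P (v x) l \subset X.
  move=> lX; apply/subsetP=> k; rewrite in_cls XE => /and3P[-> kl nk] /=.
  move: lX; rewrite XE => /andP[_]; apply: contraNN => h.
  by apply: submx_trans (span_exchange kl nk) _; rewrite addsmx_sub xac.
apply: (class_sum0 (S := P) (v := v) (U := v x)) => // l lX.
  by apply: cls_refl (nx _ lX); move: lX; rewrite XE => /andP[].
have [lP nlac] := andP (etrans (esym (XE l)) lX).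
case: (boolP (v l <= eline x)%MS) => le.
  apply: big1 => k; rewrite in_cls => /and3P[_ kl _].
  rewrite (ev_sub eu) ?mulr0 //; apply: submx_trans kl _.
  by rewrite addsmx_sub addsmxSl.
(* The class is even because [l] and [x] span an odd line, and its sign sum is at most 1 in absolute
   value. *)
have s0 : sgsum v (cls v P (v x) l) phi = 0.
  have := cls_bound l b1 phix; have := odd_absz_sgsum v (cls v P (v x) l) phi.
  rewrite (_ : [set _ in cls _ _ _ _ | _] = cls v P (v x) l); last first.
    apply/setP=> k; rewrite [k \in [set _ in _ | _]]inE.
    case: (boolP (k \in cls _ _ _ _)) => //= /(subsetP (clX l lX)).
    by rewrite XE => /andP[_ /hphi ->].
  rewrite odd_cls_even_line ?no_apex_simple //.
  rewrite -(elineE xP lP (nx _ lX)) (negbTE le) => o1 le1; apply/eqP.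
  by move: o1 le1; rewrite -absz_eq0; case: absz => [|[]].
have pl := hphi l nlac.
(* Modulo [v x] the vectors of a class are multiples of [v l], so the ratio of [u] to [phi] is
   constant on it and factors out. *)
rewrite (eq_bigr (fun k => (sgz (ev (v k) phi))%:~R * (ev (v l) u / ev (v l) phi))).
  by rewrite -mulr_suml -rmorph_sum -/(sgsum _ _ _) s0 mul0r.
move=> k; rewrite in_cls => /and3P[_ /add_rVP[c' kl] _].
have evk g : v x *m g = 0 -> ev (v k) g = c' * ev (v l) g.
  by move=> xw; have := ev_sub xw kl; rewrite evBl evZl => /eqP; rewrite subr_eq0 => /eqP.
rewrite -sgE !evk //; last exact: kills_sub (addsmxSl _ _) eu.
by rewrite -mulrA; congr (_ * _); field.
Qed.

Lemma kills_plane (x1 x2 x3 : 'rV[R]_n) g : (Q <= x1 + x2 + x3)%MS ->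
  ev x1 g = 0 -> ev x2 g = 0 -> ev x3 g = 0 -> Q *m g = 0.
Proof.
move=> sub h1 h2 h3; apply: kills_sub sub _.
by apply: kills_adds h3; apply: kills_adds h2; apply/ev_rV0.
Qed.

(** The even line through [x] as a point of the dual plane: the restriction of [f x] to [Q], written
    as a row. *)
Definition dual x : 'rV[R]_n := (Q *m f x)^T.

Lemma dual_spanP x x1 x2 : (dual x <= dual x1 + dual x2)%MS <->
  exists al be, Q *m (f x - al *: f x1 - be *: f x2) = 0.
Proof.
have E al be : (Q *m (f x - al *: f x1 - be *: f x2))^T =
    dual x - be *: dual x2 - al *: dual x1.
  by rewrite !mulmxBr -!scalemxAr !raddfB /= !linearZ addrAC.
split=> [/add_rVP[be /sub_rVP[al h]]|[al [be h]]].
  by exists al, be; apply: trmx_inj; rewrite E h subrr trmx0.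
apply/add_rVP; exists be; apply/sub_rVP; exists al.
by apply/eqP; rewrite -subr_eq0 -E h trmx0.
Qed.

Lemma dual_subP x x1 : (dual x <= dual x1)%MS <->
  exists al, Q *m (f x - al *: f x1) = 0.
Proof.
have E al : (Q *m (f x - al *: f x1))^T = dual x - al *: dual x1.
  by rewrite mulmxBr -scalemxAr raddfB /= linearZ.
split=> [/sub_rVP[al h]|[al h]].
  by exists al; apply: trmx_inj; rewrite E h subrr trmx0.
by apply/sub_rVP; exists al; apply/eqP; rewrite -subr_eq0 -E h trmx0.
Qed.

Lemma ev_self x : ev (v x) (f x) = 0.
Proof. by have [h _] := fP x; apply: ev_sub h (addsmxSl _ _). Qed.

Lemma ev_odd x l : x \in P -> l \in P -> ~~ (v l <= v x)%MS -> ~~ even_line x l ->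
  ev (v l) (f x) != 0.
Proof. by move=> xP lP nl ol; apply: (fP x).2; rewrite elineE. Qed.

Lemma plane_off_eline x l : x \in P -> l \in P -> ~~ (v l <= eline x)%MS ->
  (Q <= v x + v (y x) + v l)%MS.
Proof.
by move=> xP lP nl; have [yxP ny _ _] := yP xP; apply: sub_plane_eq; rewrite ?planeP ?plane_neq0.
Qed.

(** As [x] is off the even line of [l], [f l] is nonzero at [x], where [f x] vanishes. *)
Lemma odd_dual x l : x \in P -> l \in P -> ~~ (v l <= v x)%MS -> ~~ even_line x l ->
  ~~ (dual l <= dual x)%MS.
Proof.
move=> xP lP nl ol; apply/negP => /dual_subP[al h].
have /negP := ev_odd lP xP (plane_parC xP nl) (etrans (congr1 negb (even_lineC l x)) ol).
apply; have := ev_sub h (planeP xP); rewrite evDr evNr evZr ev_self mulr0 subr0.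
by move=> ->.
Qed.

Lemma even_dual x l : x \in P -> l \in P -> even_line x l -> ~~ (v l <= v x)%MS ->
  (dual l <= dual x)%MS.
Proof.
move=> xP lP exl nl; have [t tP nt] := off_line (v x) (v (y x)).
have [yxP ny ey uy] := yP xP; have [ylP nyl eyl uyl] := yP lP.
have lx : (v l <= eline x)%MS by rewrite elineE.
have xl : (v x <= eline l)%MS by rewrite elineE // ?(even_lineC l) // plane_parC.
have sub : (eline x <= eline l)%MS.
  rewrite addsmx_sub xl /=; apply: submx_trans (span_exchange lx nl) _.
  by rewrite addsmx_sub xl addsmxSl.
move: (sub); rewrite addsmx_sub => /andP[_ yl].
have [fl _] := fP l; have [fx _] := fP x.
apply/dual_subP; exists (ev (v t) (f l) / ev (v t) (f x)).
have ft := (fP x).2 _ nt.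
apply: (kills_plane (plane_off_eline xP tP nt)); rewrite evDr evNr evZr.
- by rewrite (ev_sub fl xl) ev_self mulr0 subrr.
- by rewrite (ev_sub fl yl) (ev_sub fx (addsmxSr _ _)) mulr0 subrr.
- by rewrite divfK // subrr.
Qed.

(** All three functionals vanish at the common point [b] of the even lines, and the functionals on
    the plane that vanish at [b] form a space of rank 2. The coefficients come from evaluating at
    [v c] and [v a]. *)
Lemma odd_dual_third a c k : a \in P -> c \in P -> k \in P -> ~~ (v c <= v a)%MS ->
  ~~ even_line a c -> (v k <= v a + v c)%MS -> (dual k <= dual a + dual c)%MS.
Proof.
move=> aA cP kP nac oac kac.
have [b [bQ nb hb]] := even_lines_concurrent aA cP nac oac.
have f0 x : x \in P -> (v x <= v a + v c)%MS -> ev b (f x) = 0.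
  by move=> xP h; have [fx _] := fP x; apply: ev_sub fx (hb _ xP h).
have fac := ev_odd aA cP nac oac.
have fca : ev (v a) (f c) != 0.
  by apply: ev_odd cP aA (plane_parC aA nac) _; rewrite even_lineC.
apply/dual_spanP; exists (ev (v c) (f k) / ev (v c) (f a)), (ev (v a) (f k) / ev (v a) (f c)).
have sub : (Q <= v a + v c + b)%MS by apply: sub_plane_eq; rewrite ?planeP ?plane_neq0.
apply: (kills_plane sub); rewrite !(evDr, evNr, evZr) ?f0 ?addsmxSl ?addsmxSr //.
- by rewrite ev_self mulr0 subr0 divfK // subrr.
- by rewrite ev_self mulr0 subr0 divfK // subrr.
- by rewrite !mulr0 !subr0.
Qed.

Lemma dual_neq0 x : x \in P -> dual x != 0.
Proof.
move=> xP; have [t tP nt] := off_line (v x) (v (y x)).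
apply: contraTneq ((fP x).2 _ nt) => h; rewrite negbK.
have Qf : Q *m f x = 0 by apply: trmx_inj; rewrite trmx0.
by rewrite (ev_sub Qf (planeP tP)).
Qed.

(** Sylvester-Gallai in the dual plane: two distinct dual points come from an odd line, whose third
    point supplies a third dual point. *)
Lemma duals_collinear k : k \in P -> (dual k <= dual i + dual j)%MS.
Proof.
move=> kP; apply: (@sylvester_gallai _ _ _ P dual) => //; first exact: dual_neq0.
  move=> a c aA cP nd.
  have nac : ~~ (v c <= v a)%MS.
    apply: contraNN nd => h.
    have : c \in flat v P (v a) by rewrite in_flat cP.
    by rewrite no_apex_simple // in_set1 => /eqP->.
  have oac : ~~ even_line a c by apply: contraNN nd => h; apply: even_dual.
  have [_ _ [l [lP lac nla nlc]]] := odd_lineP aA cP nac oac.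
  exists l; split=> //; first exact: odd_dual_third.
    by apply: odd_dual => //; rewrite (even_line_eq lac nla).
  have lca : (v l <= v c + v a)%MS by rewrite addsmxC.
  by apply: odd_dual => //; rewrite (even_line_eq lca nlc) even_lineC.
exact: odd_dual.
Qed.

Lemma no_apex_dual : False.
Proof.
have [b [bQ nb hb]] := even_lines_concurrent iP jP nij odd_ij.
(* On the plane [f k] is a combination of [f i] and [f j], which vanish at [b]; so every even line
   passes through [b]. *)
have bl k : k \in P -> (b <= eline k)%MS.
  move=> kP; have [al [be h]] := (dual_spanP _ _ _).1 (duals_collinear kP).
  have [fi _] := fP i; have [fj _] := fP j; have [fk gk] := fP k.
  have := ev_sub h bQ; rewrite !(evDr, evNr, evZr).
  rewrite (ev_sub fi (hb _ iP (addsmxSl _ _))) (ev_sub fj (hb _ jP (addsmxSr _ _))).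
  rewrite !mulr0 !subr0 => bk.
  have [t tP nt] := off_line (v k) (v (y k)).
  have /add_rVP[c' hc] := submx_trans bQ (plane_off_eline kP tP nt).
  have := ev_sub fk hc; rewrite evBl evZl bk sub0r => /eqP.
  rewrite oppr_eq0 mulf_eq0 (negbTE (gk _ nt)) orbF => /eqP c0.
  by move: hc; rewrite c0 scale0r subr0.
have b0 : b != 0 by apply: contraNneq nb => ->; exact: sub0mx.
(* If [b] were the point [k], all even lines would pass through [k], making it an apex. *)
have nkb k : k \in P -> ~~ (v k <= b)%MS.
  move=> kP; apply/negP => kb; apply: (no_apex kP) => l lP nl.
  rewrite even_lineC -elineE //; last exact: plane_parC.
  exact: submx_trans kb (bl _ lP).
have nbk k : k \in P -> ~~ (b <= v k)%MS.
  by move=> kP; apply: contraNN (nkb _ kP); exact: rV_parC.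
have [k kP nk] := off_line (v i) (v j).
(* Sylvester-Gallai is applied to [P] with [b] added as [None]: an even line contains [b], an odd
   line a third point of [P], and the line from [l] to [b] contains [y l]. *)
pose x (o : option T) := if o is Some l then v l else b.
pose A := None |: [set Some l | l in P].
have inA l : (Some l \in A) = (l \in P).
  by rewrite !inE /= mem_imset // => ? ? [].
have NA : None \in A by rewrite !inE.
move/negP: nk; apply.
apply: (@sylvester_gallai _ _ _ A x _ _ (Some i) (Some j) (Some k)); rewrite ?inA //.
  by case=> [l|_] //=; rewrite inA => /plane_neq0.
have th l : l \in P -> exists o, [/\ o \in A, (x o <= v l + b)%MS,
    ~~ (x o <= v l)%MS & ~~ (x o <= b)%MS].
  move=> lP; have [ylP nyl _ _] := yP lP.
  exists (Some (y l)); rewrite inA /= ylP nyl nkb //; split=> //.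
  by apply: span_exchange (bl _ lP) (nbk _ lP).
case=> [a|] [c|]; rewrite ?inA => aA cA //= nac.
- case: (boolP (even_line a c)) => eac.
    exists None; rewrite NA !nbk //; split=> //.
    apply: submx_trans (bl _ aA) _; rewrite addsmx_sub addsmxSl /=.
    by apply: (span_exchange _ nac); rewrite elineE.
  have [_ _ [l [lP lac nla nlc]]] := odd_lineP aA cA nac eac.
  by exists (Some l); rewrite inA.
- exact: th.
- have [o [h1 h2 h3 h4]] := th _ cA; exists o; split=> //.
  by rewrite addsmxC.
- by rewrite submx_refl in nac.
Qed.

End Dual.

Lemma no_apex_absurd : False.
Proof.
have [y yP] := fin_all_exists unique_even_line.
have [f fP] := fin_all_exists (fun x => (exists2P _ _).1 (generic_functional v (v x + v (y x))%MS)).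
exact: (no_apex_dual yP fP).
Qed.

End NoApex.

Lemma plane_structure : exists z, [/\ z \in P, ~~ (v z <= v i + v j)%MS
  & forall k, k \in P -> k != z -> (v k <= v i + v j)%MS].
Proof.
have [z [zP evz]] : exists z, z \in P /\ all_even z.
  by apply/not_existsP => none; apply: no_apex_absurd => z zP evz; apply: (none z).
exists z; split=> //; first exact: apex_off_odd.
by move=> k; exact: apex_rest.
Qed.

End Plane.

(** * Rank at least 4: two disjoint odd lines *)

Section TwoLines.
Variables (R : realFieldType) (n : nat) (T : finType) (v : T -> 'rV[R]_n).
Implicit Types (a b i j k l w : T).

Notation zero := (0 : 'M[R]_n).

Variable S : {set T}.
Hypotheses (aS : antipodal_free v S) (bS : bounded v S zero 2).
Hypothesis rankS : forall x1 x2 x3 : 'rV[R]_n,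
  exists2 l, l \in S & ~~ (v l <= x1 + x2 + x3)%MS.

Local Notation even_line a b := (~~ odd #|flat v S (v a + v b)%MS|).
Local Notation simple a := (flat v S (v a) = [set a]).

Lemma space_parC i j : i \in S -> ~~ (v j <= v i)%MS -> ~~ (v i <= v j)%MS.
Proof. by move=> iS; apply: contraNN; apply: rV_parC; exact: antipodal_free_neq0 iS. Qed.

Lemma plane_even_line i a b : i \in S -> a \in S -> b \in S -> simple i ->
  ~~ (v a <= v i)%MS -> ~~ (v b <= v i + v a)%MS ->
  exists j, [/\ j \in S, (v j <= v i + v a + v b)%MS, ~~ (v j <= v i)%MS & even_line i j].
Proof.
move=> iS aA bA si na nb; set M := (v i + v a + v b)%MS.
have iM : (v i <= M)%MS by exact: submx_trans (addsmxSl _ _) (addsmxSl _ _).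
have eP := plane_even aS bS iS aA bA na nb.
have si' : flat v (flat v S M) (v i) = [set i] by rewrite flat_flat.
have iP : i \in flat v S M by rewrite in_flat iS.
have [j []] := exists_even_line si' eP iP; rewrite in_flat => /andP[jS jM] nj.
by rewrite flat_flat ?addsmx_sub ?iM // => ej; exists j.
Qed.

(** Two distinct even lines through [i] span a plane containing all the others. Conversely, for [l]
    in that plane, the plane through [i], [l] and a point outside contains an even line through [i];
    this lies in both planes, so it is the line of [i] and [l]. *)
Lemma even_hyperplane i : i \in S -> simple i -> exists j k, [/\ j \in S, k \in S
  & forall l, l \in S -> ~~ (v l <= v i)%MS -> (v l <= v i + v j + v k)%MS = even_line i l].
Proof.
move=> iS si.
have outside2 (x1 x2 : 'rV[R]_n) : exists2 l, l \in S & ~~ (v l <= x1 + x2)%MS.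
  have [l lS nl] := rankS x1 x2 0; exists l => //.
  by apply: contraNN nl => h; exact: submx_trans h (addsmxSl _ _).
have outside1 (x1 : 'rV[R]_n) : exists2 l, l \in S & ~~ (v l <= x1)%MS.
  have [l lS nl] := outside2 x1 0; exists l => //.
  by apply: contraNN nl => h; exact: submx_trans h (addsmxSl _ _).
have [a aA na] := outside1 (v i); have [b bA nb] := outside2 (v i) (v a).
have [j [jS _ nj ej]] := plane_even_line iS aA bA si na nb.
(* The plane of [i], [c], [d] does not contain [j], so its even line through [i] differs from the
   first one. *)
have [c cS nc] := outside2 (v i) (v j); have [d dS nd] := rankS (v i) (v j) (v c).
have nc' : ~~ (v c <= v i)%MS.
  by apply: contraNN nc => h; exact: submx_trans h (addsmxSl _ _).
have icd : (v i + v c <= v i + v j + v c)%MS.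
  by rewrite addsmx_sub addsmxSr andbT; exact: submx_trans (addsmxSl _ _) (addsmxSl _ _).
have nd' : ~~ (v d <= v i + v c)%MS.
  by apply: contraNN nd => h; exact: submx_trans h icd.
have [k [kS kM nk ek]] := plane_even_line iS cS dS si nc' nd'.
have nkj : ~~ (v k <= v i + v j)%MS.
  apply/negP => kij.
  case: (boolP (v k <= v i + v c)%MS) => h.
    move/negP: nc; apply; apply: submx_trans (span_exchange h nk) _.
    by rewrite addsmx_sub addsmxSl.
  move/negP: nd; apply; apply: submx_trans (span_exchange kM h) _.
  by rewrite addsmx_sub icd; apply: submx_trans kij (addsmxSl _ _).
exists j, k; split=> // l lS nl; apply/idP/idP => [lM|el]; last first.
  exact: (even_lines_coplanar aS bS iS jS kS lS si nj nl ej ek el nkj).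
apply: contraT => ol.
have [g gS ng] := rankS (v i) (v j) (v k).
have ng' : ~~ (v g <= v i + v l)%MS.
  apply: contraNN ng => h; apply: submx_trans h _.
  by rewrite addsmx_sub lM andbT; exact: submx_trans (addsmxSl _ _) (addsmxSl _ _).
have [m [mS mM nm em]] := plane_even_line iS lS gS si nl ng'.
have mH := even_lines_coplanar aS bS iS jS kS mS si nj nm ej ek em nkj.
have mil : (v m <= v i + v l)%MS.
  apply: contraT => h; move/negP: ng; case; apply: submx_trans (span_exchange mM h) _.
  by rewrite !addsmx_sub lM mH !andbT; exact: submx_trans (addsmxSl _ _) (addsmxSl _ _).
by move: em; rewrite (flat_eqmx _ _ (line_eqmx mil nm)) (negbTE ol).
Qed.

Lemma even_pencil x a b l : x \in S -> a \in S -> b \in S -> l \in S -> simple x ->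
  ~~ (v a <= v x)%MS -> ~~ (v b <= v x + v a)%MS -> ~~ (v l <= v x)%MS ->
  (v l <= v x + v a + v b)%MS ->
  even_line x a -> even_line x b -> even_line x l.
Proof.
move=> xS aA bA lS sx na nb nl lM ea eb.
have nb' : ~~ (v b <= v x)%MS.
  by apply: contraNN nb => h; exact: submx_trans h (addsmxSl _ _).
have [j [k [jS kS H]]] := even_hyperplane xS sx.
rewrite -H //; apply: submx_trans lM _.
have ha : (v a <= v x + v j + v k)%MS by rewrite H.
have hb : (v b <= v x + v j + v k)%MS by rewrite H.
by rewrite !addsmx_sub ha hb !andbT; exact: submx_trans (addsmxSl _ _) (addsmxSl _ _).
Qed.

Section OddLine.
Variables (i j : T).
Hypotheses (iS : i \in S) (jS : j \in S) (nij : ~~ (v j <= v i)%MS).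
Hypothesis odd_ij : ~~ even_line i j.

(** Inside the plane the hypotheses of [plane_structure] hold, and its exceptional point can only be
    [w]. *)
Lemma plane_over_odd_line w k : w \in S -> k \in S -> ~~ (v w <= v i + v j)%MS ->
  (v k <= v i + v j + v w)%MS -> k != w -> (v k <= v i + v j)%MS.
Proof.
move=> wS kS nw kM kw; set M := (v i + v j + v w)%MS in kM; pose P := flat v S M.
have ijM : (v i + v j <= M)%MS by exact: addsmxSl.
have [iM jM] : (v i <= M)%MS /\ (v j <= M)%MS by apply/andP; rewrite -addsmx_sub.
have wM : (v w <= M)%MS by exact: addsmxSr.
have inP l : (l \in P) = (l \in S) && (v l <= M)%MS by rewrite in_flat.
have aP : antipodal_free v P := antipodal_freeS (flat_subset _ _ _) aS.
have bP : bounded v P zero 2 := bounded_flat bS (sub0mx _ _).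
have eP : ~~ odd #|P| by exact: plane_even.
have [iP jP wP kP] : [/\ i \in P, j \in P, w \in P & k \in P].
  by rewrite !inP iS jS wS kS iM jM wM kM.
have planeP l : l \in P -> (v l <= M)%MS by rewrite inP => /andP[].
have lineE a b : a \in P -> b \in P -> flat v P (v a + v b)%MS = flat v S (v a + v b)%MS.
  by move=> aP' bP'; rewrite flat_flat // addsmx_sub !planeP.
have pencilP x a b l : x \in P -> a \in P -> b \in P -> l \in P ->
    flat v P (v x) = [set x] -> ~~ (v a <= v x)%MS -> ~~ (v b <= v x + v a)%MS ->
    ~~ (v l <= v x)%MS -> ~~ odd #|flat v P (v x + v a)%MS| ->
    ~~ odd #|flat v P (v x + v b)%MS| -> ~~ odd #|flat v P (v x + v l)%MS|.
  move=> xP aP' bP' lP; rewrite !lineE // flat_flat ?planeP // => sx na nb nl ea eb.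
  have xyz : (M <= v x + v a + v b)%MS.
    by apply: sub_plane_eq; rewrite ?planeP //; exact: antipodal_free_neq0 xP.
  have inS y : y \in P -> y \in S by rewrite inP => /andP[].
  apply: (@even_pencil x a b) => //; try exact: inS.
  exact: submx_trans (planeP _ lP) xyz.
have odd_ij' : ~~ ~~ odd #|flat v P (v i + v j)%MS| by rewrite lineE.
have [z [zP nz rest]] := plane_structure aP bP eP iP jP wP nij nw planeP pencilP iP jP nij odd_ij'.
have zw : z = w by apply/eqP; apply: contraT; rewrite eq_sym => /(rest _ wP); rewrite (negbTE nw).
by apply: rest => //; rewrite zw.
Qed.

(** The two points lie in different planes over the odd line. If their line were even, the lines
    from [w] to [i], [j] and [w'] would all be even, hence coplanar. *)
Lemma off_odd_line_odd w w' : w \in S -> w' \in S -> w != w' ->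
  ~~ (v w <= v i + v j)%MS -> ~~ (v w' <= v i + v j)%MS ->
  [/\ ~~ (v w' <= v i + v j + v w)%MS, ~~ (v w' <= v w)%MS & ~~ even_line w w'].
Proof.
move=> wS wS' ww nw nw'.
have off : ~~ (v w' <= v i + v j + v w)%MS.
  by apply: contraNN nw' => h; apply: (plane_over_odd_line wS wS' nw h); rewrite eq_sym.
have nww : ~~ (v w' <= v w)%MS.
  by apply: contraNN off => h; apply: submx_trans h (addsmxSr _ _).
split=> //; apply/negP => e.
have sw : simple w.
  apply/eqP; rewrite eqEsubset sub1set point_refl // andbT; apply/subsetP => k.
  rewrite in_flat in_set1 => /andP[kS kw]; apply: contraT => nk.
  have h := submx_trans kw (addsmxSr (v i + v j)%MS (v w)).
  have kij := plane_over_odd_line wS kS nw h nk.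
  move/negP: nw; case; apply: submx_trans (rV_parC _ kw) kij.
  exact: antipodal_free_neq0 kS.
(* Off the odd line its plane through [w] has no point but [w], so the line from [w] to a simple
   point [a] carries just these two. *)
have wline a b : a \in S -> b \in S -> simple a -> (v a <= v i + v j)%MS ->
    (v b <= v i + v j)%MS -> even_line w a.
  move=> aA bA sa ha hb; have -> : flat v S (v w + v a)%MS = [set w; a].
    apply/setP=> k; rewrite in_flat in_set2; apply/andP/idP => [[kS kwa]|].
      case: (boolP (k == w)) => //= nk.
      have kij : (v k <= v i + v j)%MS.
        apply: (plane_over_odd_line wS kS nw _ nk); apply: submx_trans kwa _.
        by rewrite addsmx_sub addsmxSr; apply: submx_trans ha (addsmxSl _ _).
      rewrite -in_set1 -sa in_flat kS; apply: contraT => nka.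
      move/negP: nw; case; rewrite addsmxC in kwa.
      by apply: submx_trans (span_exchange kwa nka) _; rewrite addsmx_sub ha.
    by move=> /orP[] /eqP->; rewrite ?wS ?aA ?addsmxSl ?addsmxSr.
  rewrite cards2; case: eqP => // wa; move: nw; rewrite wa ha //.
have odd_ij' : odd #|flat v S (v i + v j)%MS| by rewrite -[odd _]negbK.
have [si sj _] := odd_line aS bS iS jS nij odd_ij'.
have ei := wline i j iS jS si (addsmxSl _ _) (addsmxSr _ _).
have ej := wline j i jS iS sj (addsmxSr _ _) (addsmxSl _ _).
have niw : ~~ (v i <= v w)%MS.
  apply: space_parC => //; apply: contraNN nw => h.
  exact: submx_trans h (addsmxSl _ _).
have njw : ~~ (v j <= v w + v i)%MS.
  apply: contraNN nw; rewrite addsmxC => h.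
  exact: span_exchange h nij.
have := even_lines_coplanar aS bS wS iS jS wS' sw niw nww ei ej e njw.
by rewrite -addsmxA addsmxC (negbTE off).
Qed.

End OddLine.

Theorem two_odd_lines : exists i j w w', let A := flat v S (v i + v j)%MS in
  let B := flat v S (v w + v w')%MS in
  [/\ A :|: B = S, [disjoint A & B], bounded v A zero 1 /\ bounded v B zero 1,
      (2 < #|A|)%N & (2 < #|B|)%N].
Proof.
have [p pS np] := rankS 0 0 0; have [q qS nq] := rankS (v p) 0 0.
have [r rS nr] := rankS (v p) (v q) 0.
have npq : ~~ (v q <= v p)%MS.
  by apply: contraNN nq => h; apply: submx_trans h _; rewrite -addsmxA addsmxSl.
have npqr : ~~ (v r <= v p + v q)%MS.
  by apply: contraNN nr => h; apply: submx_trans h _; rewrite addsmxSl.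
(* An ordinary line provides a simple point [i]; a point off the plane of the even lines through [i]
   then provides an odd line. *)
have [i [b [iS bA nib fib]]] := ordinary_line aS bS pS qS rS npq npqr.
have si : simple i.
  apply/eqP; rewrite eqEsubset sub1set point_refl // andbT; apply/subsetP => k.
  rewrite in_flat => /andP[kS ki].
  have : k \in flat v S (v i + v b)%MS.
    by rewrite in_flat kS; apply: submx_trans ki (addsmxSl _ _).
  rewrite fib !inE => /orP[] // /eqP kb; move: nib; rewrite -kb ki //.
have [a [c [aA cS H]]] := even_hyperplane iS si.
have [j jS nj] := rankS (v i) (v a) (v c).
have nij : ~~ (v j <= v i)%MS.
  by apply: contraNN nj => h; apply: submx_trans h _; rewrite -addsmxA addsmxSl.
have odd_ij : ~~ even_line i j by rewrite -H.
have [w wS nw] := rankS (v i) (v j) 0; have [w' wS' nw'] := rankS (v i) (v j) (v w).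
have off (x : T) (y : 'rV[R]_n) : ~~ (v x <= v i + v j + y)%MS -> ~~ (v x <= v i + v j)%MS.
  by apply: contraNN => h; apply: submx_trans h (addsmxSl _ _).
have ww : w != w' by apply: contraNneq nw' => ->; exact: addsmxSr.
have [_ nww odd_ww] := off_odd_line_odd iS jS nij odd_ij wS wS' ww (off _ _ nw) (off _ _ nw').
have coll k : k \in S -> ~~ (v k <= v i + v j)%MS -> (v k <= v w + v w')%MS.
  move=> kS nk; pose W := [set l in S | ~~ (v l <= v i + v j)%MS].
  apply: (@sylvester_gallai _ _ _ W v); rewrite ?inE ?wS ?wS' ?kS ?(off _ _ nw) ?(off _ _ nw') //.
    by move=> l; rewrite inE => /andP[lS _]; exact: antipodal_free_neq0 lS.
  move=> x y; rewrite !inE => /andP[xS nx] /andP[yS ny] nxy.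
  have xy : x != y by apply: contraNneq nxy => ->; exact: submx_refl.
  have [nyx _ ] := off_odd_line_odd iS jS nij odd_ij xS yS xy nx ny.
  rewrite negbK => oxy; have [_ _ [l [lS lxy nlx nly]]] := odd_line aS bS xS yS nxy oxy.
  (* The third point [l] is off the first line, since otherwise [y] would lie in the plane spanned
     by that line and [x]. *)
  exists l; split=> //; rewrite inE lS; apply: contraNN nyx => lij.
  apply: submx_trans (span_exchange lxy nlx) _.
  by rewrite addsmx_sub addsmxSr; apply: submx_trans lij (addsmxSl _ _).
exists i, j, w, w' => A B.
have line_ok x y : x \in S -> y \in S -> ~~ (v y <= v x)%MS -> ~~ even_line x y ->
    bounded v (flat v S (v x + v y)%MS) zero 1 /\ (2 < #|flat v S (v x + v y)%MS|)%N.
  move=> xS yS nxy; rewrite negbK => oxy; split.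
    apply: odd_bounded1 oxy; last exact: bounded_flat bS (sub0mx _ _).
    by move=> l; rewrite in_flat => /andP[lS _]; exact: antipodal_free_neq0 lS.
  have : [set x; y] \subset flat v S (v x + v y)%MS.
    apply/subsetP=> l; rewrite !inE => /orP[] /eqP->.
      by rewrite xS addsmxSl.
    by rewrite yS addsmxSr.
  move/subset_leq_card; rewrite cards2.
  have -> : x != y by apply: contraNneq nxy => ->; exact: submx_refl.
  by move: oxy; case: #|_| => [|[|[]]].
have [bA' cA] := line_ok _ _ iS jS nij odd_ij.
have [bB cB] := line_ok _ _ wS wS' nww odd_ww.
split=> //.
  apply/setP=> k; rewrite in_setU !in_flat; case: (boolP (k \in S)) => //= kS.
  by apply/orP; case: (boolP (v k <= v i + v j)%MS) => [|/(coll _ kS)]; [left | right].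
rewrite -setI_eq0; apply/eqP/setP=> k; rewrite in_setI !in_flat in_set0.
apply/negP => /andP[/andP[kS kij] /andP[_ kw]].
have nkw : ~~ (v k <= v w)%MS.
  apply: contraNN (off _ _ nw) => h.
  by apply: submx_trans (rV_parC _ h) kij; exact: antipodal_free_neq0 kS.
move/negP: nw'; apply; apply: submx_trans (span_exchange kw nkw) _.
by rewrite addsmx_sub addsmxSr; apply: submx_trans kij (addsmxSl _ _).
Qed.

End TwoLines.

(** * Codegree, discrepancy and the decomposition *)

Section Decomposition.
Variables (R : realType) (N n : nat) (V : 'M[R]_(N, n)).
Hypotheses (n0 : (0 < n)%N) (nzV : forall i : 'I_N, row i V != 0).
Implicit Types (S A B : {set 'I_N}) (u : 'cV[R]_n).

Local Notation v := (fun i : 'I_N => row i V).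
Local Notation zero := (0 : 'M[R]_n).
Local Notation codeg := (codeg_star V).
Local Notation DD := (DD V).

Lemma sgsum_pos_neg S u :
  sgsum v S u = (pos_count V S u)%:Z - (neg_count V S u)%:Z.
Proof.
have cE (P : pred 'I_N) : #|[set i in S | P i]|%:Z = \sum_(i in S) (P i)%:Z.
  rewrite -[LHS]natz -sumr_const [RHS]big_mkcond [LHS]big_mkcond /=.
  by apply: eq_bigr => i _; rewrite inE; case: (i \in S); case: (P i).
rewrite /pos_count /neg_count !cE -sumrB; apply: eq_bigr => i _.
rewrite -[fval V u i]/(ev (row i V) u).
by case: (ltrgt0P (ev (row i V) u)) => [h|h|->]; rewrite ?(gtr0_sgz h) ?(ltr0_sgz h) ?sgz0.
Qed.

Lemma disc_sgsum S u : disc V S u = `|sgsum v S u|%N.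
Proof. by rewrite sgsum_pos_neg. Qed.

Lemma bounded_DD S : bounded v S zero (DD S).
Proof.
move=> u _; rewrite -disc_sgsum /Defs.DD; case: ex_maxnP => m _ max; apply: max.
by apply/asboolP; exists u.
Qed.

Lemma DD_attained S : exists u, `|sgsum v S u|%N = DD S.
Proof.
rewrite /Defs.DD; case: ex_maxnP => m /asboolP[u <-] _.
by exists u; rewrite disc_sgsum.
Qed.

Lemma DD_le S D : bounded v S zero D -> (DD S <= D)%N.
Proof. by move=> bS; have [u <-] := DD_attained S; apply: bS; rewrite mul0mx. Qed.

Lemma eq_DD S A : (forall u, sgsum v S u = sgsum v A u) -> DD S = DD A.
Proof.
move=> h; apply/eqP; rewrite eqn_leq; apply/andP; split; apply: DD_le => u.
  by rewrite h; exact: bounded_DD.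
by rewrite -h; exact: bounded_DD.
Qed.

Lemma pos_nneg_count S u : (pos_count V S u + nneg_count V S u)%N = #|S|.
Proof.
rewrite -(cardsID [set i | 0 < fval V u i] S); congr addn; apply: eq_card => i.
  by rewrite !inE.
by rewrite !inE leNgt andbC.
Qed.

Lemma neg_le_nneg_count S u : (neg_count V S u <= nneg_count V S u)%N.
Proof.
apply: subset_leq_card; apply/subsetP=> i; rewrite !inE => /andP[-> /ltW].
by [].
Qed.

(** An extremal functional leaves no discrepancy to its zero set, so a generic perturbation keeps
    its sign sum and moves all vectors off the hyperplane. *)
Lemma maximal_functional S : exists u, [/\ u != 0, sgsum v S u = (DD S)%:Z
  & neg_count V S u = nneg_count V S u].
Proof.
case: (set_0Vmem S) => [->|[i iS]].
  exists (const_mx 1); have e0 : sgsum v set0 (const_mx 1) = 0 by rewrite /sgsum big_set0.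
  split.
  - apply/eqP => /matrixP/(_ (Ordinal n0) 0); rewrite !mxE => /eqP.
    by rewrite oner_eq0.
  - rewrite e0; have [u <-] := DD_attained set0; by rewrite /sgsum big_set0.
  - by apply: eq_card => j; rewrite !inE.
have [u0 hu0] := DD_attained S.
have [w hw] : exists w, sgsum v S w = (DD S)%:Z.
  by case E : (sgsum v S u0) hu0 => [m|m] /= <-; [exists u0 | exists (- u0); rewrite sgsumN E].
have [g _ hg] := generic_functional v zero.
have gi j : ev (row j V) g != 0 by rewrite hg // submx0 nzV.
have [e e0 he] := perturbed_sign v w g.
have nz j : ev (row j V) (w + e *: g) != 0.
  rewrite -[_ == 0]sgz_eq0 he; case: ifP => [_|/negbT]; rewrite sgz_eq0 //.
exists (w + e *: g); split.
- by apply: contraNneq (nz i) => ->; rewrite /ev mulmx0 mxE.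
- have := zero_set_bound w g (@bounded_DD S); rewrite hw => z0.
  have s0 : sgsum v (flat v S (kermx w)) g = 0.
    by apply/eqP; rewrite -absz_eq0 -leqn0 -(leq_add2l (DD S)) addn0.
  rewrite -hw -[RHS]addr0 -s0 sgsum_flat -big_split; apply: eq_bigr => j _ /=.
  rewrite he (sub_kermx_ev v j w); case: eqP => [->|_]; last by rewrite addr0.
  by rewrite sgz0 add0r.
- by apply: eq_card => j; rewrite !inE lt_neqAle [fval _ _ _ == 0](negbTE (nz j)).
Qed.

(** For an extremal functional missing all vectors, the positive and nonpositive counts have sum
    [#|S|] and difference [DD S]. For every other functional the difference is at most [DD S], so
    its nonpositive count is no smaller. *)
Lemma codeg_star_card S : (2 * codeg S + DD S)%N = #|S|.
Proof.
have [u [u0 hu hn]] := maximal_functional S.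
rewrite /codeg_star; case: pselect => [h|[]]; last first.
  by exists (nneg_count V S u); apply/asboolP; exists u.
case: ex_minnP => m /asboolP[w [w0 hw]] min.
have le : (m <= nneg_count V S u)%N by apply: min; apply/asboolP; exists u.
have := bounded_DD S (mul0mx _ w); rewrite sgsum_pos_neg => bw.
have := pos_nneg_count S u; have := pos_nneg_count S w.
have := neg_le_nneg_count S w; move: hu; rewrite sgsum_pos_neg.
move: bw le; rewrite -hn -hw.
move: (neg_count V S u) (pos_count V S u) (neg_count V S w) (pos_count V S w).
move: (nneg_count V S w) (DD S) #|S|.
by move=> *; lia.
Qed.

Definition span_rank S : nat := \rank (\sum_(i in S) <<row i V>>)%MS.

Lemma span_rank_le S m (M : 'M[R]_(m, n)) :
  (forall i, i \in S -> (row i V <= M)%MS) -> (span_rank S <= \rank M)%N.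
Proof.
by move=> h; apply: mxrankS; apply/sumsmx_subP => i iS; rewrite genmxE h.
Qed.

Lemma sub_span S i : i \in S -> (row i V <= \sum_(i in S) <<row i V>>)%MS.
Proof. by move=> iS; apply: (sumsmx_sup i) => //; rewrite genmxE. Qed.

Lemma span_rank_leD1 S A i : (forall j, j \in S -> j \in A \/ (row j V <= row i V)%MS) ->
  (span_rank S <= (span_rank A).+1)%N.
Proof.
move=> h; apply: leq_trans (rank_add_rV_le _ (row i V)); apply: span_rank_le => j /h[jA|].
  by apply: submx_trans (sub_span jA) (addsmxSl _ _).
by move=> hj; apply: submx_trans hj (addsmxSr _ _).
Qed.

Lemma span_rank_card S : (span_rank S <= #|S|)%N.
Proof.
move: {2}#|S| (erefl #|S|) => m; elim: m S => [|m IH] S hS; rewrite hS.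
  rewrite -(@mxrank0 R 0 n); apply: span_rank_le => i.
  by rewrite (cards0_eq hS) inE.
have /card_gt0P[i iS] : (0 < #|S|)%N by rewrite hS.
have hS' : #|S :\ i| = m by move: hS; rewrite (cardsD1 i) iS => -[].
apply: (@leq_trans (span_rank (S :\ i)).+1); last by rewrite ltnS -[m in (_ <= m)%N]hS' IH.
apply: (@span_rank_leD1 _ _ i) => j jS.
by rewrite in_setD1 jS andbT; case: eqP => [->|_]; [right | left].
Qed.

(** Vectors in none of the sets form the part V_0. The length bound is stated additively, without
    truncated subtraction. *)
Definition decomposes S (ps : seq {set 'I_N}) :=
  [/\ pairwise (fun A B => [disjoint A & B]) ps, all (fun A : {set 'I_N} => A \subset S) ps,
      all (fun A => 0 < codeg A)%N ps, codeg S = (\sum_(A <- ps) codeg A)%N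
    & (span_rank S <= size ps + DD S)%N].

Lemma antipodal_free_decomposes S : antipodal_free v S -> (DD S <= 2)%N ->
  exists ps, decomposes S ps.
Proof.
move=> aS D2; have cS := codeg_star_card S; have bS := @bounded_DD S.
(* With codegree 0, [#|S|] equals [DD S] and bounds the rank, so the empty sequence is long
   enough. *)
case: (posnP (codeg S)) => [c0|cpos].
  exists [::]; split=> //; first by rewrite big_nil.
  by move: cS; rewrite c0 muln0 !add0n => ->; exact: span_rank_card.
case: (leqP (span_rank S) (1 + DD S)) => [le1|gt1].
  by exists [:: S]; split; rewrite ?big_seq1 //= ?andbT ?subxx.
have low i j : i \in S -> j \in S -> ~~ (row j V <= row i V)%MS -> (DD S <= 1)%N ->
    (span_rank S <= 2)%N.
  move=> iS jS nij D1; apply: (@leq_trans (\rank (row i V + row j V)%MS)).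
    apply: span_rank_le => k kS; apply: (@bounded1_collinear _ _ _ v S i j k) => //.
    by move=> u hu; apply: leq_trans D1; exact: bS.
  by apply: leq_trans (rank_add_rV_le _ _) _; rewrite ltnS rank_leq_row.
have D_eq2 : DD S = 2%N.
  apply/eqP; rewrite eqn_leq D2 ltnNge /=; apply/negP => D1.
  have [i iS] : exists i, i \in S.
    by apply/card_gt0P; rewrite -cS; move: cpos; case: codeg.
  have D0 : (0 < DD S)%N.
    apply: leq_trans (@point_card_le _ _ _ v S _ i aS bS iS).
    by apply/card_gt0P; exists i; exact: point_refl.
  have DD1 : DD S = 1%N by apply/eqP; rewrite eqn_leq D1.
  move: gt1; rewrite DD1 ltnNge => /negP; apply.
  case: (pselect (forall j, j \in S -> (row j V <= row i V)%MS)) => [all1|].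
    by apply: leq_trans (span_rank_le all1) _; rewrite (leq_trans (rank_leq_row _)).
  move=> /existsNP[j] /not_implyP[jS /negP nij]; exact: low nij _.
have rankS (x1 x2 x3 : 'rV[R]_n) : exists2 l, l \in S & ~~ (row l V <= x1 + x2 + x3)%MS.
  apply/not_exists2P => h; move: gt1; rewrite D_eq2 ltnNge => /negP; apply.
  apply: (@leq_trans (\rank (x1 + x2 + x3)%MS)).
    by apply: span_rank_le => l lS; case: (h l) => // /negP; rewrite negbK.
  apply: leq_trans (rank_add_rV_le _ _) _; rewrite ltnS.
  by apply: leq_trans (rank_add_rV_le _ _) _; rewrite ltnS rank_leq_row.
have bS2 : bounded v S zero 2 by rewrite -D_eq2.
have [i [j [w [w' /= [AB dAB [bA bB] cA cB]]]]] := two_odd_lines aS bS2 rankS.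
set A := flat _ _ _ in AB dAB bA cA *; set B := flat _ _ _ in AB dAB bB cB *.
have eA := codeg_star_card A; have eB := codeg_star_card B.
have dA := DD_le bA; have dB := DD_le bB.
have card_S : #|S| = (#|A| + #|B|)%N.
  by rewrite -AB cardsU (eqP (_ : A :&: B == set0)) ?cards0 ?subn0 ?setI_eq0.
(* Sign sums add over [A] and [B], so both have discrepancy exactly 1 and the codegrees add up to
   that of [S]. *)
have DAB : (2 <= DD A + DD B)%N.
  have [u hu] := DD_attained S.
  have sAB : sgsum v S u = sgsum v A u + sgsum v B u.
    by rewrite /sgsum -AB -bigU //; apply: eq_bigl => k; rewrite !inE.
  have := bounded_DD A (mul0mx _ u); have := bounded_DD B (mul0mx _ u).
  move: hu; rewrite D_eq2 sAB; clear; lia.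
exists [:: A; B]; split.
- by rewrite /= dAB.
- by rewrite /= -AB subsetUl subsetUr.
- rewrite /= andbT; move: cA cB dA dB; rewrite -eA -eB; clear; lia.
- rewrite big_cons big_seq1; move: cS DAB dA dB; rewrite D_eq2 card_S -eA -eB; clear; lia.
- rewrite D_eq2 /=; apply: (@leq_trans (\rank (row i V + row j V + row w V + row w' V)%MS)).
    apply: span_rank_le => k; rewrite -AB in_setU !in_flat => /orP[] /andP[_ h];
      apply: submx_trans h _.
      by rewrite -addsmxA addsmxSl.
    by rewrite addsmx_sub addsmxSr andbT; apply: submx_trans (addsmxSr _ _) (addsmxSl _ _).
  do 3! (apply: leq_trans (rank_add_rV_le _ _) _; rewrite ltnS).
  exact: rank_leq_row.
Qed.

Lemma exists_decomposes S : (DD S <= 2)%N -> exists ps, decomposes S ps.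
Proof.
have [m] := ubnP #|S|; elim: m S => // m IH S; rewrite ltnS => hS D2.
case: (pselect (antipodal_free v S)) => [aS|]; first exact: antipodal_free_decomposes.
move=> /existsNP[i] /existsNP[j] /existsNP[c] /not_implyP[iS] /not_implyP[jS].
move=> /not_implyP[ji] /negP c0.
have {}c0 : c < 0.
  rewrite lt_neqAle leNgt c0 andbT; apply/eqP => cE.
  by move: (nzV j); rewrite ji cE scale0r eqxx.
have ij : i != j.
  apply/eqP => ij; move/eqP: ji; rewrite -ij -[X in X == _]scale1r -subr_eq0 -scalerBl.
  rewrite scaler_eq0 (negbTE (nzV i)) orbF subr_eq0 => /eqP c1.
  by move: c0; rewrite -c1 ltr10.
pose p := [set i; j]; pose S' := S :\: p.
have pS : p \subset S by rewrite subUset !sub1set iS.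
have cp : #|p| = 2%N by rewrite cards2 ij.
have sp u : sgsum v p u = 0.
  rewrite /sgsum big_setU1 ?big_set1 ?inE //= ji evZl sgzM (ltr0_sgz c0).
  by rewrite mulN1r subrr.
have sS u : sgsum v S u = sgsum v S' u.
  by rewrite {1}/sgsum (big_setID p) /= (setIidPr pS) -/(sgsum v p u) sp add0r.
have cS' : #|S'| = (#|S| - 2)%N by rewrite cardsDS // cp.
have c2 : (2 <= #|S|)%N by rewrite -cp subset_leq_card.
have DE := eq_DD sS.
have Dp : DD p = 0%N by apply/eqP; rewrite -leqn0; apply: DD_le => u _; rewrite sp.
have kp : codeg p = 1%N.
  by have := codeg_star_card p; rewrite cp Dp; lia.
have [||ps [dps sps pps cps rps]] := IH S'.
- by rewrite cS'; lia.
- by rewrite -DE.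
exists (p :: ps); split.
- rewrite /= dps andbT; apply/allP => A Aps; have /subsetP sA := allP sps _ Aps.
  rewrite disjoint_sym; apply: disjointWl (_ : [disjoint S' & p]).
    by apply/subsetP.
  by rewrite -setI_eq0 setIDAC setDIl setDv ?setI0 ?set0I.
- rewrite /= pS; apply/allP => A Aps; apply: subset_trans (allP sps _ Aps) _.
  exact: subsetDl.
- by rewrite /= kp.
- rewrite big_cons -cps kp.
  by have := codeg_star_card S; have := codeg_star_card S'; rewrite DE cS'; lia.
(* The pair spans a single line, so the extra piece makes up for the loss of rank. *)
- rewrite /= DE addSn; apply: leq_trans (_ : (span_rank S').+1 <= _)%N; last by rewrite ltnS.
  apply: (@span_rank_leD1 _ _ i) => k kS; rewrite !inE kS andbT.
  case: (boolP (k == i)) => [/eqP->|ki]; first by right.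
  case: (boolP (k == j)) => [/eqP->|kj]; last by left.
  by right; rewrite ji scalemx_sub.
Qed.

End Decomposition.

(** * From disjoint sets to a labelling, and the theorem *)

Lemma codeg_decomposition_of_seq (R : realType) (N n : nat) (V : 'M[R]_(N, n))
    (ps : seq {set 'I_N}) :
  pairwise (fun A B : {set 'I_N} => [disjoint A & B]) ps ->
  all (fun A => 0 < codeg_star V A)%N ps ->
  codeg_star V setT = (\sum_(A <- ps) codeg_star V A)%N ->
  exists c : 'I_N -> option 'I_(size ps), codeg_decomposition V c.
Proof.
move=> dis pos sum; pose c i := [pick j : 'I_(size ps) | i \in nth set0 ps j].
have disj (j k : 'I_(size ps)) : (j < k)%N -> [disjoint nth set0 ps j & nth set0 ps k].
  by move=> jk; apply: (pairwiseP set0 dis) => //; rewrite inE ltn_ord.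
have partE j : part c j = nth set0 ps j.
  apply/setP=> i; rewrite inE /c; case: pickP => [k ik|none]; last by rewrite none.
  case: (ltngtP k j) => [kj|jk|/val_inj <-]; last by rewrite ik eqxx.
    rewrite (disjointFr (disj _ _ kj) ik); apply/eqP => -[kjE].
    by rewrite kjE ltnn in kj.
  rewrite (disjointFl (disj _ _ jk) ik); apply/eqP => -[kjE].
  by rewrite kjE ltnn in jk.
exists c; split=> [|j]; last by rewrite partE; apply: (allP pos); rewrite mem_nth.
rewrite sum (big_nth set0) big_mkord; apply: eq_bigr => j _.
by rewrite partE.
Qed.

(* V : N vectors (rows) in R^n; rank r = \rank V.  A decomposition
   V = V_0 ⊎ V_1 ⊎ ... ⊎ V_m is encoded by c : 'I_N -> option 'I_m. *)
Theorem mainTheorem2 (R : realType) (N n : nat) (V : 'M[R]_(N, n)) :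
  (forall i : 'I_N, row i V != 0) ->
  (DD V setT <= 2)%N ->
  exists (m : nat) (c : 'I_N -> option 'I_m),
    (\rank V - DD V setT <= m)%N /\ codeg_decomposition V c.
Proof.
move=> nzV D2; case: (posnP n) => [n0|n0].
  (* In dimension 0 there is no hyperplane, so the codegree is 0 by convention and the decomposition
     of length 0 works. *)
  subst n; exists 0%N, (fun=> None); split.
    by rewrite (leq_trans (leq_subr _ _)) // rank_leq_col.
  split=> [|[]//]; rewrite big_ord0 /codeg_star; case: pselect => // h.
  by case: (h) => k /asboolP[u [/eqP[]]]; rewrite flatmx0.
have [ps [dis _ pos sum rk]] := exists_decomposes n0 nzV D2.
have [c hc] := codeg_decomposition_of_seq dis pos sum.
exists (size ps), c; split=> //; rewrite leq_subLR addnC; apply: leq_trans rk.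
apply: mxrankS; apply/row_subP => i; exact: sub_span.
Qed.
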